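(* Let $\mathcal{K}=\mathcal{R}$ (resp. $\mathcal{K}=\mathcal{C}$), let $A$ be an $n\times n$ positive definite symmetric matrix over $\mathcal{R}$ (resp. positive definite Hermitian matrix over $\mathcal{C}$), and let $w:2^{[n]}\to\mathbb{R}$, $w(S)=\nu(A_S)$. Then the regular subdivision of $[0,1]^n$ induced by $w$ (via the upper hull) is a coarsening of a subdivision of $[0,1]^n$ into dehomogenized matroid polytopes of matroids realizable over $\mathbb{R}$ (resp. over $\mathbb{C}$).
   Context: $\mathcal{R}$ is a real closed field with a nontrivial valuation $\mathrm{val}$ with infinite residue field, $\nu=-\mathrm{val}$, compatible with the order ($0<a<b\Rightarrow \nu(a)\le\nu(b)$). $\mathcal{C}=\mathcal{R}(\mathrm{i})$, $\mathrm{i}^2=-1$, with $\nu(a+\mathrm{i}b)=\max(\nu(a),\nu(b))$. $A_S$ is the principal minor of $A$ on rows/columns $S$ ($A_\emptyset=1$); a symmetric (resp. Hermitian) matrix is positive definite if all its principal minors are positive. Identify $S\subseteq[n]$ with $e_S=\sum_{i\in S}e_i\in\{0,1\}^n$. The regular subdivision of $[0,1]^n$ induced by $w$ via the upper hull is obtained by projecting to $\mathbb{R}^n$ the upper faces of the convex hull of the points $(e_S,w(S))\in\mathbb{R}^{n+1}$. A subdivision $\Sigma$ is a coarsening of $\Sigma'$ if every cell of $\Sigma$ is a union of cells of $\Sigma'$. A dehomogenized matroid polytope is the image, under deleting the last coordinate, of the base polytope $\mathrm{conv}\{e_B : B \text{ basis}\}\subseteq\mathbb{R}^{n+1}$ of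 a matroid of some rank $k+1$ on ground set $[n+1]$ ($0\le k\le n-1$); such a polytope lies in $\{x\in[0,1]^n: k\le \sum_i x_i\le k+1\}$. *)

(* Defs.v *)
From HB Require Import structures.
From mathcomp Require Import all_boot all_order all_algebra.
From mathcomp Require Import complex.
From mathcomp Require Import reals constructive_ereal.

Set Implicit Arguments.
Unset Strict Implicit.
Unset Printing Implicit Defensive.

Import Order.TTheory GRing.Theory Num.Theory.
Local Open Scope ring_scope.
Local Open Scope ereal_scope.

Section Valuation.
Variables (R : rcfType) (RR : realType).

Definition is_valuation (val : R -> \bar RR) : Prop :=
  [/\ forall x : R, val x = +oo <-> x = 0%R,
      forall x : R, val x <> -oo,
      forall x y : R, val (x * y)%R = val x + val y
    & forall x y : R, Order.min (val x) (val y) <= val (x + y)%R].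

Definition nontrivial_valuation (val : R -> \bar RR) : Prop :=
  exists x : R, x <> 0%R /\ val x <> 0.

(* residue field  O/m  (O = {val >= 0}, m = {val > 0}) is infinite:
   no finite list of elements of O represents all residue classes *)
Definition infinite_residue_field (val : R -> \bar RR) : Prop :=
  forall s : seq R, (forall y, y \in s -> 0 <= val y) ->
    exists x : R, 0 <= val x /\ forall y, y \in s -> ~ (0 < val (x - y)%R).

Definition nu (val : R -> \bar RR) (x : R) : \bar RR := - val x.

Definition order_compatible (val : R -> \bar RR) : Prop :=
  forall a b : R, (0 < a)%R -> (a < b)%R -> nu val a <= nu val b.

Definition nuC (val : R -> \bar RR) (z : R[i]) : \bar RR :=
  Order.max (nu val (@complex.Re R z)) (nu val (@complex.Im R z)).

End Valuation.

Local Close Scope ereal_scope.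

(* A_S, the principal minor on rows/columns S (A_emptyset = det of 0x0 = 1) *)
Definition pminor (K : comNzRingType) (n : nat) (A : 'M[K]_n)
    (S : {set 'I_n}) : K :=
  \det (\matrix_(i < #|S|, j < #|S|)
          A (@enum_val _ (pred_of_set S) i) (@enum_val _ (pred_of_set S) j)).

Definition posdef (K : numDomainType) (n : nat) (A : 'M[K]_n) : Prop :=
  forall S : {set 'I_n}, 0 < pminor A S.

Definition symmetric_mx (K : ringType) (n : nat) (A : 'M[K]_n) : Prop :=
  A^T = A.

Definition hermitian_mx (R : rcfType) (n : nat) (A : 'M[R[i]]_n) : Prop :=
  A^T = map_mx (@conjc R) A.

Section Geometry.
Variable RR : realFieldType.

Definition ind (n : nat) (S : {set 'I_n}) : 'rV[RR]_n :=
  \row_i (if i \in S then 1 else 0).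

Definition dot (n : nat) (c x : 'rV[RR]_n) : RR := \sum_i c 0 i * x 0 i.

Definition conv (n : nat) (V : {set {set 'I_n}}) : 'rV[RR]_n -> Prop :=
  fun x => exists l : {set 'I_n} -> RR,
    [/\ forall S, 0 <= l S, \sum_(S in V) l S = 1
      & x = \sum_(S in V) l S *: ind S].

Definition cube (n : nat) : 'rV[RR]_n -> Prop :=
  fun x => forall i, 0 <= x 0 i <= 1.

Definition is_face (n : nat) (F P : 'rV[RR]_n -> Prop) : Prop :=
  exists c : 'rV[RR]_n,
    forall x, F x <-> (P x /\ forall y, P y -> dot c y <= dot c x).

(* Sig is a polyhedral subdivision of [0,1]^n whose cells are the
   polytopes conv D, D in Sig (each cell given by its set of 0/1 vertices):
   nonempty cells, covering the cube, closed under taking faces, and any two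
   cells meet in a common face (or not at all). *)
Definition subdivision_of_cube (n : nat) (Sig : {set {set {set 'I_n}}}) : Prop :=
  [/\ forall D, D \in Sig -> D != set0,
      forall x, cube x <-> exists2 D, D \in Sig & conv D x,
      forall D F, D \in Sig -> is_face F (conv D) ->
        exists2 D', D' \in Sig & forall x, F x <-> conv D' x
    & forall D D', D \in Sig -> D' \in Sig ->
        (forall x, ~ (conv D x /\ conv D' x)) \/
        (is_face (fun x => conv D x /\ conv D' x) (conv D) /\
         is_face (fun x => conv D x /\ conv D' x) (conv D'))].

(* Cells of the regular subdivision of [0,1]^n induced by w via the upper
   hull: projections of the upper faces of conv{(e_S, w S)}.  An upper face is
   the face maximizing (c,1).(x,t) for some c in RR^n; its projection is the
   convex hull of the e_S with S maximizing  c.e_S + w S. *)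
Definition upper_face_vertices (n : nat) (w : {set 'I_n} -> RR) (c : 'rV[RR]_n)
    : {set {set 'I_n}} :=
  [set S | [forall T, dot c (ind T) + w T <= dot c (ind S) + w S]].

Definition regular_cell (n : nat) (w : {set 'I_n} -> RR)
    (P : 'rV[RR]_n -> Prop) : Prop :=
  exists c : 'rV[RR]_n, forall x, P x <-> conv (upper_face_vertices w c) x.

Definition regular_coarsening_of (n : nat) (w : {set 'I_n} -> RR)
    (Sig : {set {set {set 'I_n}}}) : Prop :=
  forall P, regular_cell w P ->
    exists2 T : {set {set {set 'I_n}}}, T \subset Sig &
      forall x, P x <-> exists2 D, D \in T & conv D x.

End Geometry.

Arguments conv {RR n} V _.
Arguments cube {RR n} _.
Arguments subdivision_of_cube RR {n} Sig.

Definition is_matroid_bases (m r : nat) (Bs : {set {set 'I_m}}) : Prop :=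
  [/\ Bs != set0,
      forall B, B \in Bs -> #|B| = r
    & forall B1 B2, B1 \in Bs -> B2 \in Bs -> forall x, x \in B1 :\: B2 ->
        exists2 y, y \in B2 :\: B1 & (B1 :\ x) :|: [set y] \in Bs].

Definition colsB (F : fieldType) (r m : nat) (M : 'M[F]_(r, m)) (B : {set 'I_m})
    : 'M[F]_(r, #|B|) :=
  \matrix_(i < r, j < #|B|) M i (@enum_val _ (pred_of_set B) j).

Definition realizable_over (F : fieldType) (m r : nat) (Bs : {set {set 'I_m}})
    : Prop :=
  exists M : 'M[F]_(r, m),
    forall B : {set 'I_m}, B \in Bs <-> (#|B| = r /\ \rank (colsB M B) = #|B|).

Definition drop_last (RR : ringType) (n : nat) (y : 'rV[RR]_n.+1) : 'rV[RR]_n :=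
  \row_i y 0 (widen_ord (leqnSn n) i).

Definition realizable_dehom_matroid_polytope (RR : realFieldType)
    (F : fieldType) (n : nat) (P : 'rV[RR]_n -> Prop) : Prop :=
  exists (k : nat) (Bs : {set {set 'I_n.+1}}),
    [/\ (k < n)%N, is_matroid_bases k.+1 Bs, realizable_over F k.+1 Bs
      & forall x, P x <-> exists2 y, conv Bs y & x = drop_last y].

Definition coarsens_realizable_matroid_subdivision (RR : realFieldType)
    (F : fieldType) (n : nat) (w : {set 'I_n} -> RR) : Prop :=
  exists Sig : {set {set {set 'I_n}}},
    [/\ subdivision_of_cube RR Sig,
        forall D, D \in Sig -> realizable_dehom_matroid_polytope F (@conv RR n D)
      & regular_coarsening_of w Sig].

(* Main.v *)
(* Write A = U^* U and X = G U with G a generic integer matrix.  Then A_S and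
   |det X_{[k],S}|^2, k = |S|, are equal up to bounded rational factors: they have the
   same archimedean class, which is finer than the valuation.  On the layers k, k+1 the
   classes of the A_S are the squared maximal minors of the first k+1 rows of X bordered
   by e_{k+1}, so each of their initial matroids is realized over R (or C) by the
   standard part of a suitably scaled and row-reduced matrix.  Working with the standard
   part instead of the residue field avoids transferring realizability between real
   closed fields, and it only refines the subdivision.

   The archimedean classes take values in an ordered group of possibly infinite rank.
   By Motzkin's transposition theorem there is a real height function u satisfying the
   same finitely many integral sign conditions, and then so does w1 = N w + u for every N;
   these conditions include the certificates excluding all cells that are not initial.
   They also include A_S A_T <~ A_{S+y} A_{T-y} for |S| < |T| and some y in T \ S (a
   cofactor expansion), which makes the regular cells of w1 - |S|^2 lie between two
   adjacent layers.  For N large the regular subdivision of w1 - |S|^2 refines that of w. *)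

Require Import Defs.
From HB Require Import structures.
From mathcomp Require Import all_boot all_order all_algebra.
From mathcomp Require Import perm.
From mathcomp Require Import complex.
From mathcomp Require Import boolp reals constructive_ereal.
From mathcomp Require classical_sets.
From mathcomp Require Import ring lra.

Set Implicit Arguments.
Unset Strict Implicit.
Unset Printing Implicit Defensive.

Import Order.TTheory GRing.Theory Num.Theory.
Local Open Scope ring_scope.

(** * Motzkin's transposition theorem in ordered modules *)

(** The valuation is only weakly monotone on archimedean classes: a form in the minors that is
    strictly positive there may be sent to 0. In [N w + u] the first summand never has the wrong
    sign and the second restores strictness, whatever [N] is. Finitely many forms suffice because a
    refutation depends on the cell alone: if no linear function with values in the group selects a
    family of sets, Motzkin's multipliers are integers whose linear part cancels, so the same
    integers exclude every real linear function, for any heights giving one form its sign. The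
    comparison with flag minors rests on a normalization: divide the columns of [U] in [S] by a
    square block whose determinant is largest up to bounded factors. By Cramer's rule the quotient
    has finite entries; it contains an identity block, so its standard part has full rank and its
    Gram determinant is finite and not infinitesimal. The standard part fixes integers, so
    genericity of [G] is tested over the residual real or complex numbers and used upstairs. *)

Lemma total_has_max (T : Type) (le : T -> T -> Prop) :
  (forall x y, le x y \/ le y x) -> (forall y x z, le x y -> le y z -> le x z) ->
  forall s : list T, s = nil \/
    exists2 m, List.In m s & forall x, List.In x s -> le x m.
Proof.
move=> tot tr; elim=> [|x s IHs]; [by left | right].
have rx : le x x by case: (tot x x).
case: IHs => [-> | [m ms Hm]]; first by exists x => [|z [<-|[]]]; [left|].
case: (tot x m) => Hxm.
  by exists m => [|z [<-|/Hm]]; [right| |].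
by exists x => [|z [<-|/Hm Hz]]; [left| |apply: tr Hz Hxm].
Qed.

(** A total preorder given by its nonnegative vectors; [v] and [- v] may both be nonnegative, so
    archimedean classes need not be formed as a quotient. Divisibility supplies roots and midpoints;
    a strictly positive vector supplies room beyond a strict bound. *)
Record preordered (D : realDomainType) (V : lmodType D) (nn : V -> Prop) : Prop :=
  Preordered {
    nn_total : forall v, nn v \/ nn (- v);
    nn_add : forall u v, nn u -> nn v -> nn (u + v);
    nn_scale : forall (a : D) (v : V), 0 <= a -> nn v -> nn (a *: v);
    nn_cancel : forall (a : D) (v : V), 0 < a -> nn (a *: v) -> nn v;
    nn_div : forall (a : D) (v : V), 0 < a -> exists u : V, a *: u = v;
    nn_nontrivial : exists v, ~ nn (- v) }.

Section Elimination.
Variables (D : realDomainType) (V : lmodType D) (nn : V -> Prop).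
Hypothesis nnP : preordered nn.

Definition spos (v : V) := ~ nn (- v).

Lemma sp_nn v : spos v -> nn v.
Proof. by case: (nn_total nnP v). Qed.

Lemma nn0 : nn 0.
Proof. by case: (nn_total nnP 0); rewrite ?oppr0. Qed.

Lemma sp_addl u v : spos u -> nn v -> spos (u + v).
Proof.
move=> su nv H; apply: su.
have -> : - u = - (u + v) + v by rewrite opprD addrNK.
exact: nn_add.
Qed.

Lemma sp_addr u v : nn u -> spos v -> spos (u + v).
Proof. by move=> nu sv; rewrite addrC; apply: sp_addl. Qed.

Lemma sp_scale (a : D) v : 0 < a -> spos v -> spos (a *: v).
Proof. by move=> a0 sv; rewrite /spos -scalerN => /(nn_cancel nnP a0). Qed.

Lemma sp_cancel (a : D) v : 0 < a -> spos (a *: v) -> spos v.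
Proof. by move=> a0 sv H; apply: sv; rewrite -scalerN; apply: nn_scale => //; apply: ltW. Qed.

Variable J : finType.

Record ineq := Ineq { coef : J -> D; cst : V; strict : bool }.

Definition lhs (r : ineq) (d : J -> V) : V := \sum_j coef r j *: d j + cst r.

Definition sign_ok (s : bool) (v : V) : Prop := if s then spos v else nn v.

Definition sat (r : ineq) (d : J -> V) : Prop := sign_ok (strict r) (lhs r d).

Definition ineq_add (r q : ineq) : ineq :=
  Ineq (fun j => coef r j + coef q j) (cst r + cst q) (strict r || strict q).

Definition ineq_scale (a : D) (r : ineq) : ineq :=
  Ineq (fun j => a * coef r j) (a *: cst r) (strict r).

(** Combinations are nonempty and scalars positive, never zero, so one strict summand makes the
    whole combination strict. *)
Inductive cone (L : list ineq) : ineq -> Prop :=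
| ConeIn r of List.In r L : cone L r
| ConeAdd r q of cone L r & cone L q : cone L (ineq_add r q)
| ConeScale a r of 0 < a & cone L r : cone L (ineq_scale a r).

Lemma cone_cone (L L' : list ineq) r :
  (forall q, List.In q L' -> cone L q) -> cone L' r -> cone L r.
Proof.
move=> H; elim=> {r} [r /H // | r q _ Hr _ Hq | a r a0 _ Hr].
- exact: ConeAdd.
- exact: ConeScale.
Qed.

Lemma lhs_add r q d : lhs (ineq_add r q) d = lhs r d + lhs q d.
Proof.
rewrite /lhs /= addrACA; congr (_ + _).
by rewrite -big_split; apply: eq_bigr => j _; rewrite scalerDl.
Qed.

Lemma lhs_scale a r d : lhs (ineq_scale a r) d = a *: lhs r d.
Proof.
rewrite /lhs /= scalerDr; congr (_ + _).
by rewrite scaler_sumr; apply: eq_bigr => j _; rewrite scalerA.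
Qed.

Lemma lhs_upd r d (j0 : J) t :
  lhs r (fun j => if j == j0 then t else d j) =
  lhs r d + coef r j0 *: (t - d j0).
Proof.
rewrite /lhs (bigD1 j0) //= (bigD1 (P := xpredT) j0) //= eqxx.
rewrite (eq_bigr (fun j => coef r j *: d j)) => [|j /negPf -> //].
by rewrite scalerBr [RHS]addrCA -!addrA; congr (_ + _); rewrite [RHS]addrC -!addrA addNr addr0.
Qed.

Lemma lhs_coef0 r d : (forall j, coef r j = 0) -> lhs r d = cst r.
Proof. by move=> H; rewrite /lhs big1 ?add0r // => j _; rewrite H scale0r. Qed.

Definition pos_ineqs (j0 : J) L := List.filter (fun r => 0 < coef r j0) L.
Definition neg_ineqs (j0 : J) L := List.filter (fun r => coef r j0 < 0) L.
Definition zero_ineqs (j0 : J) L := List.filter (fun r => coef r j0 == 0) L.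

(** The weights cancel [j0], and both are positive when [coef q j0 < 0 < coef r j0]. *)
Definition combine (j0 : J) (r q : ineq) :=
  ineq_add (ineq_scale (- coef q j0) r) (ineq_scale (coef r j0) q).

Definition eliminate (j0 : J) (L : list ineq) : list ineq :=
  List.app (zero_ineqs j0 L)
    (List.flat_map (fun r => List.map (combine j0 r) (neg_ineqs j0 L)) (pos_ineqs j0 L)).

Lemma in_eliminate j0 L r : List.In r (eliminate j0 L) <->
  (List.In r L /\ coef r j0 = 0) \/
  exists p q, [/\ List.In p L, 0 < coef p j0, List.In q L, coef q j0 < 0 &
     r = combine j0 p q].
Proof.
rewrite /eliminate List.in_app_iff List.in_flat_map List.filter_In.
split=> [[[rL /eqP c0]|[p [/List.filter_In[pL p0] /List.in_map_iff[q [<- /List.filter_In[qL q0]]]]]]|].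
- by left.
- by right; exists p, q.
case=> [[rL c0]|[p [q [pL p0 qL q0 ->]]]]; first by left; rewrite c0 eqxx.
right; exists p; split; first by apply/List.filter_In.
by apply/List.in_map_iff; exists q; split=> //; apply/List.filter_In.
Qed.

Lemma eliminate_cone j0 L r : List.In r (eliminate j0 L) -> cone L r.
Proof.
case/in_eliminate=> [[rL _]|[p [q [pL p0 qL q0 ->]]]]; first exact: ConeIn.
by apply: ConeAdd; apply: ConeScale; rewrite ?oppr_gt0 //; apply: ConeIn.
Qed.

Lemma eliminate_coef j0 L r : List.In r (eliminate j0 L) -> coef r j0 = 0.
Proof.
case/in_eliminate=> [[_ //]|[p [q [_ _ _ _ ->]]]] /=.
by rewrite mulNr mulrC addNr.
Qed.

(** Only the largest lower and the smallest upper bound matter, and their midpoint works; if one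
    list is empty, shift the extreme of the other by a strictly positive vector. *)
Lemma between (lo up : list (V * bool)) :
  (forall l h, List.In l lo -> List.In h up -> sign_ok (l.2 || h.2) (h.1 - l.1)) ->
  exists t, (forall l, List.In l lo -> sign_ok l.2 (t - l.1)) /\
            (forall h, List.In h up -> sign_ok h.2 (h.1 - t)).
Proof.
move=> H.
have sok s v : spos v -> sign_ok s v by case: s => // /sp_nn.
pose le (x y : V * bool) := nn (y.1 - x.1).
have tot x y : le x y \/ le y x.
  by rewrite /le -(opprB y.1); exact: nn_total nnP _.
have tr y x z : le x y -> le y z -> le x z.
  by move=> h1 h2; rewrite /le -(subrKA y.1); apply: (nn_add nnP).
have [v0 sv0] := nn_nontrivial nnP.
pose ge x y := le y x.
have tot' x y : ge x y \/ ge y x by exact: tot.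
have tr' y x z : ge x y -> ge y z -> ge x z by move=> h1 h2; apply: tr h2 h1.
have [lo0|[l lL Hl]] := total_has_max tot tr lo;
have [up0|[h hL Hh]] := total_has_max tot' tr' up.
- by exists 0; rewrite lo0 up0.
- exists (h.1 - v0); rewrite lo0; split=> [q []|q qL].
  have Hq : nn (q.1 - h.1) by exact: Hh.
  apply: sok.
  by rewrite opprB addrCA; apply: sp_addl.
- exists (l.1 + v0); rewrite up0; split=> [q qL|q []].
  have Hq : nn (l.1 - q.1) by exact: Hl.
  apply: sok.
  by rewrite addrAC; apply: sp_addr.
have two0 : (0 : D) < 2%:R by rewrite ltr0n.
have [t Ht] := nn_div nnP (l.1 + h.1) two0.
have sgc s v : sign_ok s (2%:R *: v) -> sign_ok s v.
  case: s => /=; first exact: sp_cancel.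
  exact: (nn_cancel nnP).
have sga s u v : nn u -> sign_ok s v -> sign_ok s (u + v).
  by case: s => /= hu hv; [apply: sp_addr | apply: (nn_add nnP)].
have sgw s s' v : sign_ok (s || s') v -> sign_ok s v /\ sign_ok s' v.
  by case: s s' => [] [] //= Hv; split=> //; apply: sp_nn.
(* For a lower bound [q], twice [t - q] is [(l - q) + (h - q)]: the first term is nonnegative, the
   second carries the strictness of [q] itself, which may differ from that of [l]. *)
exists t; split=> q qL; apply: sgc; rewrite scalerBr Ht scaler_nat mulr2n opprD addrACA.
- by apply: sga; [exact: Hl|have /sgw[] := H _ _ qL hL].
- by rewrite addrC; apply: sga; [exact: Hh|have /sgw[] := H _ _ lL qL].
Qed.

(** Fourier-Motzkin elimination. Eliminated inequalities lie in the cone of the old ones, so a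
    contradiction lifts; a solution extends by a value between the roots of the inequalities with
    positive and with negative coefficient. *)
Lemma motzkin (L : list ineq) :
  (exists d, forall r, List.In r L -> sat r d) \/
  (exists2 r, cone L r & (forall j, coef r j = 0) /\ ~ sign_ok (strict r) (cst r)).
Proof.
suff main (vs : seq J) : forall L : list ineq,
    (forall r j, List.In r L -> j \notin vs -> coef r j = 0) ->
    (exists d, forall r, List.In r L -> sat r d) \/
    (exists2 r, cone L r & (forall j, coef r j = 0) /\ ~ sign_ok (strict r) (cst r)).
  by apply: (main (enum J)) => r j _; rewrite mem_enum.
elim: vs => [|j0 vs IH] {}L HL.
  case: (pselect (exists2 r, List.In r L & ~ sat r (fun=> 0))) => [[r rL nsat]|nex].
    right; exists r; first exact: ConeIn.
    have c0 j : coef r j = 0 by apply: HL.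
    by split=> //; rewrite -(lhs_coef0 (fun=> 0) c0).
  by left; exists (fun=> 0) => r rL; apply: contrapT => ns; apply: nex; exists r.
have HL' r j : List.In r (eliminate j0 L) -> j \notin vs -> coef r j = 0.
  move=> rL jvs; have [->|nj] := eqVneq j j0; first exact: eliminate_coef rL.
  have jv : j \notin j0 :: vs by rewrite inE negb_or nj.
  case/in_eliminate: rL => [[rL _]|[p [q [pL p0 qL q0 ->]]]]; first exact: HL.
  by rewrite /= !(HL _ _ _ jv) // !mulr0 addr0.
case: (IH _ HL') => [[d Hd]|[r rc Hr]]; last first.
  by right; exists r => //; apply: cone_cone rc => q; apply: eliminate_cone.
left.
pose e r := lhs r d - coef r j0 *: d j0.
have Eupd r t : lhs r (fun j => if j == j0 then t else d j) = e r + coef r j0 *: t.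
  by rewrite lhs_upd scalerBr addrCA addrC addrAC.
(* [root r] is the value of the variable [j0] at which the left side of [r] vanishes. *)
have /choice [root Hroot] : forall r : ineq, exists t, coef r j0 != 0 -> coef r j0 *: t = - e r.
  move=> r; have [->|nz] := eqVneq (coef r j0) 0; first by exists 0.
  have [c0|c0|c0] := ltgtP (coef r j0) 0; last by rewrite c0 eqxx in nz.
    have c0' : 0 < - coef r j0 by rewrite oppr_gt0.
    have [u Hu] := nn_div nnP (e r) c0'; exists u => _.
    by rewrite -Hu scaleNr opprK.
  by have [u Hu] := nn_div nnP (- e r) c0; exists u.
pose bd r := (root r, strict r).
have [|t [Hlo Hup]] := @between (List.map bd (pos_ineqs j0 L)) (List.map bd (neg_ineqs j0 L)).
  move=> l h /List.in_map_iff[r [<- /List.filter_In[rL r0]]].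
  move=> /List.in_map_iff[q [<- /List.filter_In[qL q0]]] /=.
  have /Hd : List.In (combine j0 r q) (eliminate j0 L).
    by apply/in_eliminate; right; exists r, q.
  rewrite /sat /= lhs_add !lhs_scale.
  have -> : - coef q j0 *: lhs r d + coef r j0 *: lhs q d =
     (coef r j0 * - coef q j0) *: (root q - root r).
    have rE : lhs r d = coef r j0 *: (d j0 - root r).
      rewrite scalerBr Hroot ?gt_eqF //.
      by rewrite opprK /e addrC subrK.
    have qE : lhs q d = coef q j0 *: (d j0 - root q).
      rewrite scalerBr Hroot ?lt_eqF //.
      by rewrite opprK /e addrC subrK.
    rewrite rE qE !scalerA mulrN [- coef q j0 * _]mulrC mulrN !scaleNr !scalerBr.
    by rewrite !opprB addrA subrK addrC.
  have cpos : 0 < coef r j0 * - coef q j0 by rewrite mulr_gt0 ?oppr_gt0.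
  by case: (_ || _) => /=; [apply: sp_cancel | apply: (nn_cancel nnP)].
exists (fun j => if j == j0 then t else d j) => r rL.
rewrite /sat Eupd.
have [c0|c0|c0] := ltgtP (coef r j0) 0.
- have /Hup /= : List.In (bd r) (List.map bd (neg_ineqs j0 L)).
    by apply/List.in_map_iff; exists r; split=> //; apply/List.filter_In.
  have -> : e r + coef r j0 *: t = (- coef r j0) *: (root r - t).
    by rewrite scalerBr !scaleNr Hroot ?lt_eqF // !opprK.
  have c0' : 0 < - coef r j0 by rewrite oppr_gt0.
  case: (strict r) => /=; first exact: sp_scale.
  by apply: (nn_scale nnP); apply: ltW.
- have /Hlo /= : List.In (bd r) (List.map bd (pos_ineqs j0 L)).
    by apply/List.in_map_iff; exists r; split=> //; apply/List.filter_In.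
  have -> : e r + coef r j0 *: t = coef r j0 *: (t - root r).
    by rewrite scalerBr Hroot ?gt_eqF // opprK addrC.
  case: (strict r) => /=; first exact: sp_scale.
  by apply: (nn_scale nnP); apply: ltW.
- rewrite c0 scale0r addr0 /e c0 scale0r subr0.
  by apply: Hd; apply/in_eliminate; left.
Qed.

End Elimination.

(** * Regular subdivisions of the cube *)

Lemma preordered_regular (F : realFieldType) : @preordered F F^o (fun v => 0 <= v).
Proof.
split=> [v|u v|a v|a v|a v|].
- by rewrite oppr_ge0; exact/orP/le_total.
- exact: addr_ge0.
- exact: mulr_ge0.
- by move=> a0; rewrite pmulr_rge0.
- by move=> a0; exists (a^-1 * v); rewrite /GRing.scale /= mulVKf ?gt_eqF.
- by exists 1; rewrite oppr_ge0 ler10.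
Qed.

Lemma preordered_int (F : realFieldType) : @preordered int (zmodule F) (fun v : F => 0 <= v).
Proof.
split=> [v|u v|a v|a v|a v|].
- by rewrite oppr_ge0; exact/orP/le_total.
- exact: addr_ge0.
- by move=> a0 v0; rewrite scalezrE -mulrzr mulr_ge0 ?ler0z.
- by move=> a0; rewrite scalezrE -mulrzr pmulr_lge0 ?ltr0z.
- move=> a0; exists (v * (a%:~R)^-1 : F); rewrite scalezrE -mulrzr divfK //.
  by rewrite intr_eq0 gt_eqF.
- by exists (1 : F); rewrite oppr_ge0 ler10.
Qed.

Section Conv.
Variables (F : realFieldType) (n : nat).
Implicit Types (c d x : 'rV[F]_n) (S T : {set 'I_n}) (D E L : {set {set 'I_n}}).
Implicit Types (u w : {set 'I_n} -> F).

Notation ev c S := (dot c (ind F S)).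

Lemma dot_suml (L : {set {set 'I_n}}) l c :
  dot c (\sum_(S in L) l S *: ind F S) = \sum_(S in L) l S * ev c S.
Proof.
rewrite /dot; under eq_bigr do rewrite summxE mulr_sumr.
rewrite exchange_big /=; apply: eq_bigr => S _; rewrite mulr_sumr.
by apply: eq_bigr => i _; rewrite !mxE mulrCA.
Qed.

Lemma dotDl c d x : dot (c + d) x = dot c x + dot d x.
Proof. by rewrite /dot -big_split; apply: eq_bigr => i _; rewrite mxE mulrDl. Qed.

Lemma dotZl a c x : dot (a *: c) x = a * dot c x.
Proof. by rewrite /dot mulr_sumr; apply: eq_bigr => i _; rewrite mxE mulrA. Qed.

Lemma dotNl c x : dot (- c) x = - dot c x.
Proof. by rewrite -scaleN1r dotZl mulN1r. Qed.

Lemma ev_sum c S : ev c S = \sum_(i in S) c 0 i.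
Proof.
rewrite /dot [RHS]big_mkcond; apply: eq_bigr => i _.
by rewrite mxE; case: ifP; rewrite ?mulr1 ?mulr0.
Qed.

Lemma conv_supp D L l x : D \subset L -> (forall S, 0 <= l S) ->
  \sum_(S in L) l S = 1 -> x = \sum_(S in L) l S *: ind F S ->
  (forall S, S \in L -> S \notin D -> l S = 0) -> conv D x.
Proof.
move=> DL l0 l1 -> lD; exists l.
have E (M : lmodType F) (f : {set 'I_n} -> M) : (forall S, S \in L -> S \notin D -> f S = 0) ->
    \sum_(S in L) f S = \sum_(S in D) f S.
  move=> H; rewrite (bigID (mem D)) /= [X in _ + X]big1 ?addr0.
    by apply: eq_bigl => S; rewrite andbC; case: (boolP (S \in D)) => // /(subsetP DL) ->.
  by move=> S /andP[]; apply: H.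
split=> //; first by rewrite -l1; apply/esym/(E F^o).
by apply: E => S SL SD; rewrite lD // scale0r.
Qed.

Lemma conv_sub D L x : D \subset L -> conv D x -> conv L x.
Proof.
move=> DL [l [l0 l1 ->]].
have E (M : lmodType F) (f : {set 'I_n} -> M) :
    \sum_(S in D) f S = \sum_(S in L) (if S \in D then f S else 0).
  rewrite -big_mkcondr; apply: eq_bigl => S.
  by case: (boolP (S \in D)) => [/(subsetP DL) ->|_]; rewrite ?andbF.
exists (fun S => if S \in D then l S else 0); split.
- by move=> S; case: ifP.
- by rewrite -l1; apply/esym/(E F^o).
- by rewrite E; apply: eq_bigr => S _; case: ifP; rewrite ?scale0r.
Qed.

Lemma conv_nonempty D x : conv D x -> D != set0.
Proof.
case=> l [_ l1 _]; apply/negP => /eqP D0; move: l1.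
by rewrite D0 big_set0 => /eqP; rewrite eq_sym oner_eq0.
Qed.

Lemma conv_ind D S : S \in D -> conv D (ind F S).
Proof.
move=> SD; exists (fun T => (T == S)%:R); split.
- by move=> T; rewrite ler0n.
- by rewrite (bigD1 S) //= eqxx big1 ?addr0 // => T /andP[_ /negPf ->].
- rewrite (bigD1 S) //= eqxx scale1r big1 ?addr0 // => T /andP[_ /negPf ->].
  by rewrite scale0r.
Qed.

Lemma sum_eq0_ge0 L (f : {set 'I_n} -> F) : (forall S, S \in L -> 0 <= f S) ->
  \sum_(S in L) f S <= 0 -> forall S, S \in L -> f S = 0.
Proof.
move=> f0 s0 S SL; apply/eqP; rewrite eq_le f0 // andbT.
apply: le_trans s0; rewrite (bigD1 S) //= lerDl sumr_ge0 // => T /andP[TL _].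
exact: f0.
Qed.

(** Motzkin's theorem with unknown gradient: an infeasibility certificate, divided by its total
    weight, is a barycentric representation of [x] reaching or exceeding height [z]. A strict
    separation is opposed to a weak inequality of heights, and conversely. *)
Lemma farkas_conv (s : bool) L u x z :
  (exists c, forall S, S \in L -> if s then u S + ev c S < z + dot c x
                                  else u S + ev c S <= z + dot c x) \/
  (exists l, [/\ forall S, 0 <= l S, \sum_(S in L) l S = 1,
      x = \sum_(S in L) l S *: ind F S &
      if s then z <= \sum_(S in L) l S * u S else z < \sum_(S in L) l S * u S]).
Proof.
pose rw S := @Ineq F F^o 'I_n (fun j => x 0 j - ind F S 0 j) (z - u S) s.
have inrw r : List.In r (List.map rw (enum L)) <-> exists2 S, S \in L & r = rw S.
  split=> [/List.in_map_iff[S [<- SL]]|[S SL ->]].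
    exists S => //; rewrite -mem_enum; move: SL; elim: (enum _) => //= a t IH.
    by rewrite inE => -[->|/IH ->]; rewrite ?eqxx ?orbT.
  apply/List.in_map_iff; exists S; split=> //; move: SL; rewrite -mem_enum.
  by elim: (enum _) => //= a t IH; rewrite inE => /orP[/eqP ->|/IH]; [left|right].
case: (motzkin (preordered_regular F) (List.map rw (enum L))) => [[d Hd]|[r rc [r0 rn]]].
  left; exists (\row_j d j) => S SL.
  have /Hd : List.In (rw S) (List.map rw (enum L)) by apply/inrw; exists S.
  rewrite /sat /= /lhs /=.
  have -> : \sum_j (x 0 j - ind F S 0 j) *: (d j : F^o) =
      dot (\row_j d j) x - ev (\row_j d j) S.
    rewrite /dot -sumrB; apply: eq_bigr => j _.
    by rewrite /GRing.scale /= !mxE; ring.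
  rewrite /sign_ok /spos; case: s {rw inrw Hd} => /=; last by lra.
  by move/negP; rewrite -ltNge; lra.
right.
have [l [l0 lp [lc lb ls]]] : exists l : {set 'I_n} -> F,
  [/\ forall S, 0 <= l S, 0 < \sum_(S in L) l S &
     [/\ forall j, coef r j = \sum_(S in L) l S * (x 0 j - ind F S 0 j),
      cst r = \sum_(S in L) l S * (z - u S) & strict r = s]].
  elim: {r0 rn} rc => {r} [r /inrw[S SL ->]|r q _ [l [l0 lp [lc lb ls]]] _ [m [m0 mp [mc mb ms]]]|a r a0 _ [l [l0 lp [lc lb ls]]]].
  - exists (fun T => (T == S)%:R); split; first by move=> T; rewrite ler0n.
      rewrite (bigD1 S) //= eqxx big1 ?addr0 ?ltr01 // => T /andP[_ /negPf ->] //.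
    split=> //= [j|]; rewrite (bigD1 S) //= eqxx mul1r big1 ?addr0 // => T /andP[_ /negPf ->];
      by rewrite mul0r.
  - exists (fun T => l T + m T); split; first by move=> T; rewrite addr_ge0.
      by rewrite big_split addr_gt0.
    split=> /= [j||]; rewrite ?lc ?mc ?lb ?mb ?ls ?ms ?orbb // -big_split;
      by apply: eq_bigr => T _; rewrite mulrDl.
  - exists (fun T => a * l T); split; first by move=> T; rewrite mulr_ge0 // ltW.
      by rewrite -mulr_sumr mulr_gt0.
    split=> //= [j|]; rewrite ?lc ?lb /GRing.scale /= mulr_sumr;
      by apply: eq_bigr => T _; rewrite mulrA.
(* A certificate is a nonempty positive combination, so its total weight is positive. *)
set t := \sum_(S in L) l S in lp.
have tn0 : t != 0 by rewrite gt_eqF.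
have sumt (f : {set 'I_n} -> F) : \sum_(S in L) t^-1 * l S * f S = t^-1 * \sum_(S in L) l S * f S.
  by rewrite mulr_sumr; apply: eq_bigr => S _; rewrite mulrA.
have cstE : t^-1 * cst r = z - t^-1 * \sum_(S in L) l S * u S.
  rewrite lb; under eq_bigr do rewrite mulrBr.
  by rewrite sumrB -mulr_suml -/t mulrBr mulrA mulVf // mul1r.
exists (fun S => t^-1 * l S); split.
- by move=> S; rewrite mulr_ge0 // invr_ge0 ltW.
- by rewrite -mulr_sumr mulVf.
- apply/rowP => j; rewrite summxE.
  have := lc j; rewrite r0; under eq_bigr do rewrite mulrBr.
  rewrite sumrB -mulr_suml -/t => /esym/eqP; rewrite subr_eq0 => /eqP E.
  apply: (mulfI tn0); rewrite E mulr_sumr; apply: eq_bigr => S _.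
  by rewrite !mxE -mulrA mulVKf.
- rewrite sumt -subr_ge0 -subr_gt0 -[_ * _ - z]opprB -cstE.
  rewrite oppr_ge0 oppr_gt0 pmulr_rle0 ?pmulr_rlt0 ?invr_gt0 //.
  move: rn; rewrite ls /sign_ok /spos.
  case: s {rw inrw rc ls} => /=; last by move/negP; rewrite -ltNge.
  by move/contrapT; rewrite oppr_ge0.
Qed.

Definition argmax L u c : {set {set 'I_n}} :=
  [set S in L | [forall T in L, u T + ev c T <= u S + ev c S]].

Lemma argmaxP L u c S : reflect (S \in L /\ forall T, T \in L -> u T + ev c T <= u S + ev c S)
  (S \in argmax L u c).
Proof. by rewrite inE; apply: (iffP andP) => -[SL /forall_inP H]. Qed.

Lemma argmax_sub L u c : argmax L u c \subset L.
Proof. by apply/subsetP => S /argmaxP[]. Qed.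

Lemma argmax_neq0 L u c : L != set0 -> argmax L u c != set0.
Proof.
case/set0Pn=> S0 S0L; apply/set0Pn.
have [S SL HS] := @arg_maxP _ _ _ S0 (mem L) (fun S => u S + ev c S) S0L.
by exists S; apply/argmaxP; split=> // T TL; apply: HS.
Qed.

Lemma upper_faceE w c : upper_face_vertices w c = argmax setT w c.
Proof.
apply/setP => S; rewrite !inE /=; apply/forallP/forallP => H T; have := H T.
  by rewrite inE /= addrC [X in _ <= X]addrC.
by rewrite inE /= addrC [X in _ <= X]addrC.
Qed.

(** A convex combination maximizing [d] puts no weight where [d] is below [m]: the terms
    [l S * (m - ev d S)] are nonnegative with sum at most 0. *)
Lemma is_face_conv D E d m x : E \subset D -> E != set0 ->
  (forall S, S \in D -> ev d S <= m) ->
  (forall S, S \in D -> (ev d S == m) = (S \in E)) ->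
  conv E x <-> (conv D x /\ forall y, conv D y -> dot d y <= dot d x).
Proof.
move=> ED E0 Hm HE; split.
  move=> Ex; split; first exact: conv_sub Ex.
  case: Ex => l [l0 l1 ->] y [k [k0 k1 ->]]; rewrite !dot_suml.
  have -> : \sum_(S in E) l S * ev d S = m.
    rewrite (eq_bigr (fun S => l S * m)) -?mulr_suml ?l1 ?mul1r // => S SE.
    by congr (_ * _); apply/eqP; rewrite HE // (subsetP ED).
  apply: (@le_trans _ _ (\sum_(S in D) k S * m)); last by rewrite -mulr_suml k1 mul1r.
  by apply: ler_sum => S SD; rewrite ler_wpM2l ?Hm.
case=> [[l [l0 l1 ->]] H]; case/set0Pn: E0 => S0 S0E.
have S0D := subsetP ED _ S0E.
have := H _ (conv_ind S0D); rewrite dot_suml.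
have /eqP -> : ev d S0 == m by rewrite HE.
move=> Hle.
have Hs : forall S, S \in D -> l S * (m - ev d S) = 0.
  apply: sum_eq0_ge0 => [S SD|]; first by rewrite mulr_ge0 ?subr_ge0 ?Hm.
  by under eq_bigr do rewrite mulrBr; rewrite sumrB -mulr_suml l1 mul1r subr_le0.
apply: (conv_supp ED l0 l1) => // S SD SE.
have := Hs _ SD => /eqP; rewrite mulf_eq0 subr_eq0 [m == _]eq_sym HE // (negPf SE) orbF.
by move/eqP.
Qed.

(** Both representations of [x] lie on the upper envelope and so have the same height; hence the
    affine majorant of [c'] has no slack at the vertices that carry weight for [c]. *)
Lemma conv_argmax_meet L w c c' x : conv (argmax L w c) x -> conv (argmax L w c') x ->
  conv (argmax L w c :&: argmax L w c') x.
Proof.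
move=> [l [l0 l1 lx]] [k [k0 k1 kx]].
set D := argmax L w c in l1 lx *; set D' := argmax L w c' in k1 kx *.
have Dn0 : D != set0 by apply: (@conv_nonempty _ x); exists l.
have Dn0' : D' != set0 by apply: (@conv_nonempty _ x); exists k.
have [S0 S0D] := set0Pn _ Dn0; have [S0' S0D'] := set0Pn _ Dn0'.
pose m := w S0 + ev c S0; pose m' := w S0' + ev c' S0'.
have cl S : S \in D -> w S + ev c S = m.
  move=> SD; apply/le_anti/andP; split.
    by have /argmaxP[_ H] := S0D; apply: H; apply: (subsetP (argmax_sub _ _ _) _ SD).
  by have /argmaxP[_ H] := SD; apply: H; apply: (subsetP (argmax_sub _ _ _) _ S0D).
have le' S : S \in L -> w S + ev c' S <= m' by have /argmaxP[_ H] := S0D'; apply: H.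
have le1 S : S \in L -> w S + ev c S <= m by have /argmaxP[_ H] := S0D; apply: H.
have cl' S : S \in D' -> w S + ev c' S = m'.
  move=> SD; apply/le_anti/andP; split; first exact/le'/(subsetP (argmax_sub _ _ _) _ SD).
  by have /argmaxP[_ H] := SD; apply: H; apply: (subsetP (argmax_sub _ _ _) _ S0D').
have val1 : \sum_(S in D) l S * w S = m - dot c x.
  rewrite lx dot_suml -[m]mul1r -l1 mulr_suml -sumrB.
  by apply: eq_bigr => S SD; rewrite -mulrBr -(cl S SD) addrK.
have val2 : \sum_(S in D') k S * w S = m' - dot c' x.
  rewrite kx dot_suml -[m']mul1r -k1 mulr_suml -sumrB.
  by apply: eq_bigr => S SD; rewrite -mulrBr -(cl' S SD) addrK.
have up2 : \sum_(S in D') k S * w S <= m - dot c x.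
  rewrite kx dot_suml -[m]mul1r -k1 mulr_suml -sumrB.
  apply: ler_sum => S SD; rewrite -mulrBr ler_wpM2l // lerBrDr le1 //.
  exact: (subsetP (argmax_sub _ _ _) _ SD).
have Hs : forall S, S \in D -> l S * (m' - (w S + ev c' S)) = 0.
  apply: sum_eq0_ge0 => [S SD|].
    by rewrite mulr_ge0 // subr_ge0 le' // (subsetP (argmax_sub _ _ _) _ SD).
  under eq_bigr do rewrite mulrBr [X in _ - X]mulrDr.
  rewrite sumrB big_split /= -mulr_suml l1 mul1r val1 -dot_suml -lx.
  by move: up2; rewrite val2; lra.
apply: (conv_supp (subsetIl D D') l0 l1) => // S SD; rewrite inE SD /= => SD'.
have /eqP := Hs _ SD; rewrite mulf_eq0 => /orP[/eqP //|]; rewrite subr_eq0 => /eqP E.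
case/negP: SD'; apply/argmaxP; split; first exact: (subsetP (argmax_sub _ _ _) _ SD).
by move=> T TL; rewrite -E le'.
Qed.

(** On the cell of [c] the sum [w S + ev c S] is constant, so [c' - c] agrees with [w S + ev c' S]
    up to a constant and is largest exactly at common vertices, if there are any. *)
Lemma is_face_argmax_meet L w c c' :
  (forall x, ~ (conv (argmax L w c) x /\ conv (argmax L w c') x)) \/
  is_face (fun x => conv (argmax L w c) x /\ conv (argmax L w c') x) (conv (argmax L w c)).
Proof.
set D := argmax L w c; set D' := argmax L w c'.
have [DD0|DDn0] := eqVneq (D :&: D') set0.
  left=> x [h h']; have := conv_nonempty (conv_argmax_meet h h').
  by rewrite -/D -/D' DD0 eqxx.
right; exists (c' - c) => x.
have [S0] := set0Pn _ DDn0; rewrite inE => /andP[S0D S0D'].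
have [S0L S0max] := argmaxP _ _ _ _ S0D; have [_ S0max'] := argmaxP _ _ _ _ S0D'.
have evd S : ev (c' - c) S = ev c' S - ev c S by rewrite dotDl dotNl.
have wS S : S \in D -> w S + ev c S = w S0 + ev c S0.
  move=> /argmaxP[SL HS]; apply/le_anti; rewrite S0max //=; exact: HS.
have := @is_face_conv D (D :&: D') (c' - c) (ev c' S0 - ev c S0) x (subsetIl _ _) DDn0.
move=> <-.
- split=> [[h h']|h]; first exact: conv_argmax_meet.
  by split; apply: conv_sub h; rewrite ?subsetIl ?subsetIr.
- move=> S SD; rewrite evd; have := wS _ SD.
  have := S0max' S (subsetP (argmax_sub _ _ _) _ SD); lra.
- move=> S SD; rewrite evd inE SD /=; have E := wS _ SD.
  have SL := subsetP (argmax_sub _ _ _) _ SD.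
  apply/eqP/idP => [Eq|/argmaxP[_ H]].
    apply/argmaxP; split=> // T TL; apply: le_trans (S0max' T TL) _; lra.
  by apply/le_anti; have := H _ S0L; have := S0max' _ SL; move: E; lra.
Qed.

End Conv.
Notation ev c S := (dot c (ind _ S)).

Section Regular.
Variables (RR : realType) (n : nat).
Implicit Types (c d x : 'rV[RR]_n) (S T : {set 'I_n}) (D E L : {set {set 'I_n}}).
Implicit Types (u w : {set 'I_n} -> RR).

(** [sup V] is the height of the upper envelope over [x]. Strict separation shows that it is
    attained, weak separation that an affine majorant touches it; the weights vanish where the
    majorant has slack. *)
Lemma lp_duality L u x : conv L x -> exists c, conv (argmax L u c) x.
Proof.
move=> Lx; have Ln0 := conv_nonempty Lx.
pose V : classical_sets.set RR := fun v => exists l, [/\ forall S, 0 <= l S, \sum_(S in L) l S = 1,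
      x = \sum_(S in L) l S *: ind RR S & v = \sum_(S in L) l S * u S].
have ubV c m : (forall S, S \in L -> u S + ev c S <= m + dot c x) -> classical_sets.ubound V m.
  move=> H _ [l [l0 l1 lx ->]].
  suff : \sum_(S in L) l S * (u S + ev c S) <= m + dot c x.
    under eq_bigr do rewrite mulrDr.
    by rewrite big_split /= -dot_suml -lx lerD2r.
  apply: (@le_trans _ _ (\sum_(S in L) l S * (m + dot c x))).
    by apply: ler_sum => S SL; rewrite ler_wpM2l ?H.
  by rewrite -mulr_suml l1 mul1r.
have V0 : classical_sets.nonempty V.
  by case: Lx => l [l0 l1 lx]; exists (\sum_(S in L) l S * u S); exists l.
have maxL c : exists2 S0, S0 \in L & forall S, S \in L -> u S + ev c S <= u S0 + ev c S0.
  by have /set0Pn[S0 /argmaxP[]] := argmax_neq0 u c Ln0; exists S0.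
have sV : classical_sets.has_sup V.
  split=> //; have [S0 S0L HS0] := maxL 0.
  exists (u S0 + ev 0 S0 - dot 0 x); apply: (ubV 0) => S SL; rewrite subrK; exact: HS0.
have [[c Hc]|[l [l0 l1 lx lz]]] := farkas_conv true L u x (sup V).
  have [S0 S0L HS0] := maxL c.
  have : sup V <= u S0 + ev c S0 - dot c x.
    by apply: ge_sup => //; apply: (ubV c) => S SL; rewrite subrK HS0.
  by have := Hc _ S0L; lra.
have [[c Hc]|[k [k0 k1 kx kz]]] := farkas_conv false L u x (sup V); last first.
  have : \sum_(S in L) k S * u S <= sup V by apply: sup_upper_bound => //; exists k.
  by rewrite leNgt kz.
exists c.
have Hs : forall S, S \in L -> l S * (sup V + dot c x - (u S + ev c S)) = 0.
  apply: sum_eq0_ge0 => [S SL|]; first by rewrite mulr_ge0 // subr_ge0 Hc.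
  under eq_bigr do rewrite mulrBr [X in _ - X]mulrDr.
  rewrite sumrB big_split /= -mulr_suml l1 mul1r -dot_suml -lx.
  by rewrite opprD addrACA subrr addr0 subr_le0.
apply: (conv_supp (argmax_sub L u c) l0 l1) => // S SL SD.
have /eqP := Hs _ SL; rewrite mulf_eq0 => /orP[/eqP //|]; rewrite subr_eq0 => /eqP E.
case/negP: SD; apply/argmaxP; split=> // T TL; rewrite -E; exact: Hc.
Qed.

(** A strict separation of [x] from all vertices is refuted by the vertex of the coordinates where
    [c] is positive, which maximizes [c] on the cube. *)
Lemma cube_conv x : cube x <-> conv [set: {set 'I_n}] x.
Proof.
split=> [Hx|[l [l0 l1 ->]] i]; last first.
  rewrite summxE; apply/andP; split.
    by apply: sumr_ge0 => S _; rewrite !mxE mulr_ge0 //; case: ifP.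
  rewrite -l1; apply: ler_sum => S _; rewrite !mxE.
  by case: ifP; rewrite ?mulr1 ?mulr0.
have [[c Hc]|[l [l0 l1 lx _]]] := farkas_conv true setT (fun=> 0) x 0; last by exists l.
exfalso.
have /= := Hc [set i | 0 < c 0 i] (in_setT _); rewrite !add0r ltNge => /negP; apply.
rewrite /dot; apply: ler_sum => i _; rewrite !mxE inE.
have /andP[x0 x1] := Hx i; case: ltP => ci; first by rewrite ler_wpM2l // ltW.
by rewrite mulr0 mulr_le0_ge0.
Qed.

(* A large multiple of the first objective makes the second one act as a tie-breaker. *)
Lemma argmax_lex w u c c1 : exists N0 : nat, forall N : nat, (N0 <= N)%N ->
  argmax setT (fun S => N%:R * w S + u S) (N%:R *: c + c1) = argmax (argmax setT w c) u c1.
Proof.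
pose f S := w S + ev c S; pose g S := u S + ev c1 S.
have /choice [b Hb] : forall p : {set 'I_n} * {set 'I_n}, exists b : nat,
    f p.1 < f p.2 -> forall N : nat, (b <= N)%N -> N%:R * f p.1 + g p.1 < N%:R * f p.2 + g p.2.
  case=> S T /=; have [Hf|] := ltP (f S) (f T); last by exists 0%N.
  exists (Num.bound `|(g S - g T) / (f T - f S)|) => _ N HN.
  have d0 : 0 < f T - f S by rewrite subr_gt0.
  have : (g S - g T) / (f T - f S) < N%:R.
    apply: le_lt_trans (ler_norm _) _.
    by apply: lt_le_trans (archi_boundP (normr_ge0 _)) _; rewrite ler_nat.
  rewrite ltr_pdivrMr //; lra.
exists (\max_p b p)%N => N HN.
have Hlt S T : f S < f T -> N%:R * f S + g S < N%:R * f T + g T.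
  by move=> H; apply: (Hb (S, T)) => //; apply: leq_trans HN; apply: (leq_bigmax (S, T)).
have Hle S T : f S <= f T -> g S <= g T -> N%:R * f S + g S <= N%:R * f T + g T.
  by move=> h1 h2; apply: lerD => //; apply: ler_wpM2l.
have E S : N%:R * w S + u S + ev (N%:R *: c + c1) S = N%:R * f S + g S.
  by rewrite dotDl dotZl /f /g; ring.
apply/setP => S; apply/argmaxP/argmaxP.
  case=> _ H.
  have SD : S \in argmax setT w c.
    apply/argmaxP; split=> [|T _]; rewrite ?in_setT //; have := H T (in_setT _); rewrite !E => HT.
    by rewrite leNgt; apply/negP => /Hlt; rewrite ltNge HT.
  split=> // T TD; have := H T (in_setT _); rewrite !E.
  have -> : f S = f T; last by rewrite lerD2l.
  have [_ HS] := argmaxP _ _ _ _ SD; have [_ HT] := argmaxP _ _ _ _ TD.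
  by apply/le_anti/andP; split; [apply: HT|apply: HS]; rewrite in_setT.
case=> /argmaxP[_ HS] HS2; split=> [|T _]; rewrite ?in_setT ?E //.
have [/Hlt/ltW //|fle] := ltP (f T) (f S).
have TD : T \in argmax setT w c.
  by apply/argmaxP; split=> [|U _]; rewrite ?in_setT //; exact: le_trans (HS _ (in_setT _)) fle.
by apply: Hle; [exact: HS (in_setT _)|exact: HS2].
Qed.

Lemma argmax_scale w c (N : nat) : (0 < N)%N ->
  argmax setT (fun S => N%:R * w S) (N%:R *: c) = argmax setT w c.
Proof.
move=> N0; apply/setP => S; rewrite !inE /=.
apply: eq_forallb_in => T _; rewrite !dotZl -!mulrDr.
by rewrite ler_pM2l // ltr0n.
Qed.

(** Thresholds are chosen for pairs of vertex sets, with one representative [(c, c1)] per pair; the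
    pairs are finite in number, so one [N] serves all cells. *)
Lemma regular_refine w u : exists N : nat, forall c x, conv (argmax setT w c) x ->
  exists c', argmax setT (fun S => N%:R * w S + u S) c' \subset argmax setT w c /\
     conv (argmax setT (fun S => N%:R * w S + u S) c') x.
Proof.
have /choice [b Hb] : forall p : {set {set 'I_n}} * {set {set 'I_n}}, exists b : nat,
    (exists c c1, p.1 = argmax setT w c /\ p.2 = argmax p.1 u c1) ->
    forall N : nat, (b <= N)%N -> exists c', argmax setT (fun S => N%:R * w S + u S) c' = p.2.
  case=> L D /=.
  case: (pselect (exists c c1, L = argmax setT w c /\ D = argmax L u c1)) => [[c [c1 [-> ->]]]|n0].
    have [N0 HN0] := argmax_lex w u c c1; exists N0 => _ N HN.
    by exists (N%:R *: c + c1); apply: HN0.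
  by exists 0%N => /n0.
exists (\max_p b p)%N => c x Lx.
have [c1 Dx] := lp_duality u Lx.
have [|//|c' Hc'] := Hb (argmax setT w c, argmax (argmax setT w c) u c1) _ (\max_p b p)%N.
- by exists c, c1.
- exact: (leq_bigmax (argmax setT w c, argmax (argmax setT w c) u c1)).
by exists c'; rewrite Hc'; split=> //; apply: argmax_sub.
Qed.

Definition regular_cells w : {set {set {set 'I_n}}} :=
  [set D | `[< exists c, D = argmax setT w c >]].

Lemma regular_cellsP w D : D \in regular_cells w <-> exists c, D = argmax setT w c.
Proof. by rewrite inE; split=> /asboolP. Qed.

Lemma regular_subdivision w : subdivision_of_cube RR (regular_cells w).
Proof.
have T0 : [set: {set 'I_n}] != set0 by apply/set0Pn; exists set0.
split.
- by move=> D /regular_cellsP[c ->]; apply: argmax_neq0.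
- move=> x; rewrite cube_conv; split=> [/lp_duality - /(_ w)[c Hc]|[D _]].
    by exists (argmax setT w c) => //; apply/regular_cellsP; exists c.
  by apply: conv_sub; apply: subsetT.
- move=> D F /regular_cellsP[c ->] [d Fd].
  (* The face in direction [d] is the cell of the perturbed functional [c + d / (N0 + 1)]: break
     ties with second height 0, then rescale. *)
  have [N0 HN0] := argmax_lex w (fun=> 0) c d.
  have := HN0 N0.+1 (leqnSn _).
  have -> : argmax setT (fun S => N0.+1%:R * w S + 0) (N0.+1%:R *: c + d) =
     argmax setT w (c + N0.+1%:R^-1 *: d).
    rewrite -(argmax_scale w _ (ltn0Sn N0)) scalerDr scalerA mulfV ?pnatr_eq0 // scale1r.
    by apply/setP => S; rewrite !inE /=; apply: eq_forallb_in => T _; rewrite !addr0.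
  move=> Eq; exists (argmax setT w (c + N0.+1%:R^-1 *: d)).
    by apply/regular_cellsP; eexists.
  move=> x; rewrite Fd Eq.
  have /set0Pn[S0 S0D] : argmax (argmax setT w c) (fun=> 0) d != set0.
    by apply: argmax_neq0; apply: argmax_neq0.
  have [S0c S0m] := argmaxP _ _ _ _ S0D.
  apply: iff_sym; apply: (@is_face_conv _ _ _ _ d (ev d S0)).
  + exact: argmax_sub.
  + by apply/set0Pn; exists S0.
  + by move=> S /S0m; rewrite !add0r.
  + move=> S SD; apply/eqP/argmaxP => [E|[_ H]].
      by split=> // T /S0m; rewrite E.
    by apply/le_anti; have := H _ S0c; have := S0m _ SD; rewrite !add0r => -> ->.
- move=> D D' /regular_cellsP[c ->] /regular_cellsP[c' ->].
  have [H|H] := is_face_argmax_meet setT w c c'; first by left.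
  have [H'|H'] := is_face_argmax_meet setT w c' c.
    by left=> x [h h']; apply: (H' x).
  right; split=> //; case: H' => d Hd; exists d => x; rewrite -Hd; tauto.
Qed.

End Regular.

(** * Transfer of cells from an ordered group to the reals *)

Lemma list_InP (T : eqType) (x : T) (s : seq T) : reflect (List.In x s) (x \in s).
Proof.
elim: s => [|y s IH] /=; first by rewrite in_nil; constructor; case.
rewrite inE; apply: (iffP orP) => [[/eqP ->|/IH]|[->|/IH]]; by [left|right].
Qed.

Section Combinatorics.
Variables (RR : realType) (V : lmodType int) (nn : V -> Prop) (vv : {additive V -> RR}).
Hypotheses (nnP : preordered nn) (vv_ge0 : forall v, nn v -> 0 <= vv v).
Variables (n : nat) (a : {set 'I_n} -> V).

Local Notation sp := (spos nn).

Definition lin (al : {set 'I_n} -> int) : V := \sum_S al S *: a S.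
Definition linR (al : {set 'I_n} -> int) (w : {set 'I_n} -> RR) : RR :=
  \sum_S (al S)%:~R * w S.

Lemma vv_scale (m : int) v : vv (m *: v) = m%:~R * vv v.
Proof. by rewrite -[m]intz scaler_int raddfMz intz mulrzl. Qed.

Lemma linR_vv al : linR al (fun S => vv (a S)) = vv (lin al).
Proof. by rewrite raddf_sum; apply: eq_bigr => S _; rewrite vv_scale. Qed.

(** A certificate against [u] would be an integral relation between nonnegative forms, one of them
    strict since all constants are 0. Read in [V], it would make 0 strictly positive. *)
Lemma real_sign_model (La : list ({set 'I_n} -> int)) : exists u : {set 'I_n} -> RR,
  forall al, List.In al La ->
    (nn (lin al) -> 0 <= linR al u) /\ (sp (lin al) -> 0 < linR al u).
Proof.
pose rw al := @Ineq int (zmodule RR) {set 'I_n} al (0 : RR) `[< sp (lin al) >].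
pose L := List.map rw (List.filter (fun al => `[< nn (lin al) >]) La).
have inL r : List.In r L <-> exists2 al, List.In al La /\ nn (lin al) & r = rw al.
  rewrite /L List.in_map_iff; split=> [[al [<- /List.filter_In[alL /asboolP h]]]|[al [alL h] ->]].
    by exists al.
  by exists al; split=> //; apply/List.filter_In; split=> //; apply/asboolP.
case: (motzkin (preordered_int RR) L) => [[u Hu]|[r rc [r0 rn]]].
  exists u => al alL.
  have E : nn (lin al) -> @sat int (zmodule RR) (fun v : RR => 0 <= v) _ (rw al) u by move=> h; apply: Hu; apply/inL; exists al.
  have EL : lhs (rw al) u = linR al u.
    by rewrite /lhs /= addr0; apply: eq_bigr => S _; rewrite mulrzl.
  move: E; rewrite /sat /sign_ok EL /= /spos; case: asboolP => [h H|nh H]; split=> // h'.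
  - by have /negP := H h'; rewrite oppr_ge0 -ltNge => /ltW.
  - by have /negP := H (sp_nn nnP h); rewrite oppr_ge0 -ltNge.
exfalso.
have [h [h' h0]] : nn (\sum_S coef r S *: a S) /\
    (strict r -> sp (\sum_S coef r S *: a S)) /\ cst r = 0.
  elim: {r0 rn} rc => {r} [r /inL[al [_ h] ->]|r q _ [r1 [r2 r3]] _ [q1 [q2 q3]]|m r m0 _ [r1 [r2 r3]]].
  - by split=> //; split=> //= /asboolP.
  - rewrite /= r3 q3 addr0.
    have -> : \sum_S (coef r S + coef q S) *: a S =
       \sum_S coef r S *: a S + \sum_S coef q S *: a S.
      by rewrite -big_split; apply: eq_bigr => S _; rewrite scalerDl.
    split; first exact: (nn_add nnP).
    split=> // /orP[/r2|/q2] H; first exact: (sp_addl nnP).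
    exact: (sp_addr nnP).
  - rewrite /= r3 scaler0.
    have -> : \sum_S (m * coef r S) *: a S = m *: \sum_S coef r S *: a S.
      by rewrite scaler_sumr; apply: eq_bigr => S _; rewrite scalerA.
    split; first by apply: (nn_scale nnP) => //; apply: ltW.
    by split=> // /r2; apply: (sp_scale nnP).
have z0 : \sum_S coef r S *: a S = 0 by apply: big1 => S _; rewrite r0 scale0r.
apply: rn; rewrite h0; case E : (strict r) => //=.
have := h' E; rewrite z0 => H _; apply: H; rewrite oppr0; exact: nn0 nnP.
Qed.

Definition layers (k : nat) : {set {set 'I_n}} := [set S : {set 'I_n} | (#|S| == k) || (#|S| == k.+1)].

Definition weight (d : 'I_n -> V) (S : {set 'I_n}) : V := a S + \sum_(i in S) d i.

(* [D] consists of the maximizers over two adjacent layers, up to the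
   equivalence defined by [nn], of [a] plus a linear function with values in [V]. *)
Definition initial_cell (k : nat) (D : {set {set 'I_n}}) : Prop :=
  D \subset layers k /\ exists d B0, B0 \in D /\
  forall S, S \in layers k -> nn (weight d B0 - weight d S) /\
     (S \in D <-> nn (weight d S - weight d B0)).

(** Motzkin's theorem is applied in [V] to the conditions that [d] select [D]. The resulting
    integers are fixed before [w] and [c]; their linear part cancels, so they contradict a real
    selection of [D] once the form has the same sign at [w] as in [V]. *)
Lemma not_initial_cell k (D : {set {set 'I_n}}) : D \subset layers k -> D != set0 -> ~ initial_cell k D ->
  exists al, forall w c, D = argmax (layers k) w c ->
    (nn (lin al) /\ linR al w < 0) \/ (sp (lin al) /\ linR al w <= 0).
Proof.
move=> DL /set0Pn[B0 B0D] nI.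
pose b (S : {set 'I_n}) i : int := (i \in S)%:R.
pose up S := @Ineq int V 'I_n (fun i => b B0 i - b S i) (a B0 - a S) (S \notin D).
pose dn S := @Ineq int V 'I_n (fun i => b S i - b B0 i) (a S - a B0) false.
pose L := List.app (List.map up (enum (layers k))) (List.map dn (enum D)).
have inL r : List.In r L <-> (exists2 S, S \in layers k & r = up S) \/ (exists2 S, S \in D & r = dn S).
  rewrite /L List.in_app_iff !List.in_map_iff; split.
    case=> -[S [<- /list_InP]]; rewrite mem_enum => HS; [left|right]; by exists S.
  by case=> -[S HS ->]; [left|right]; exists S; split=> //; apply/list_InP; rewrite mem_enum.
have bsum S (d : 'I_n -> V) : \sum_i b S i *: d i = \sum_(i in S) d i.
  rewrite [RHS]big_mkcond; apply: eq_bigr => i _; rewrite /b.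
  by case: (i \in S); rewrite ?scale1r ?scale0r.
case: (motzkin nnP L) => [[d Hd]|[r rc [r0 rn]]].
  case: nI; split=> //; exists d, B0; split=> // S SL.
  have Eup : lhs (up S) d = weight d B0 - weight d S.
    rewrite /lhs /=; under eq_bigr do rewrite scalerBl.
    by rewrite sumrB !bsum /weight opprD [RHS]addrACA [RHS]addrC.
  have Edn : lhs (dn S) d = weight d S - weight d B0.
    rewrite /lhs /=; under eq_bigr do rewrite scalerBl.
    by rewrite sumrB !bsum /weight opprD [RHS]addrACA [RHS]addrC.
  have Hup : sat nn (up S) d by apply: Hd; apply/inL; left; exists S.
  have Hdn : S \in D -> sat nn (dn S) d by move=> SD; apply: Hd; apply/inL; right; exists S.
  move: Hup Hdn; rewrite /sat /sign_ok Eup Edn /= => Hup Hdn.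
  split; first by case: (S \in D) Hup => //= /(sp_nn nnP).
  split=> // H; apply: contrapT => /negP SD; move: Hup; rewrite SD /= => sH.
  by apply: sH; rewrite opprB.
(* [be] collects the multipliers. The rows [up] and [dn] are opposite on [D], so signs are
   controlled only off [D]. *)
have [be [be1 be2 be3 be4 be5]] : exists be : {set 'I_n} -> int,
  [/\ forall S, S \in layers k -> S \notin D -> 0 <= be S,
      forall S, S \notin layers k -> be S = 0,
      forall i, coef r i = \sum_S be S * (b B0 i - b S i),
      cst r = \sum_S be S *: (a B0 - a S) &
      strict r -> exists S, [/\ S \in layers k, S \notin D & 0 < be S]].
  have delta (M : lmodType int) (f : {set 'I_n} -> M) S :
      \sum_T ((T == S)%:R : int) *: f T = f S.
    rewrite (bigD1 S) //= eqxx scale1r big1 ?addr0 // => T /negPf ->.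
    by rewrite scale0r.
  elim: {r0 rn} rc => {r} [r /inL[[S SL ->]|[S SD ->]]|r q _ [be [b1 b2 b3 b4 b5]] _ [ga [g1 g2 g3 g4 g5]]|m r m0 _ [be [b1 b2 b3 b4 b5]]].
  - exists (fun T => (T == S)%:R); split=> //=.
    + by move=> T TL; case: eqP => // TS; rewrite TS SL in TL.
    + by move=> i; apply/esym; apply: (delta int^o).
    + by rewrite delta.
    + by move=> SD; exists S; rewrite eqxx.
  - exists (fun T => - (T == S)%:R); split=> //=.
    + by move=> T _ TD; case: eqP => // TS; rewrite TS SD in TD.
    + by move=> T TL; case: eqP => // TS; rewrite TS (subsetP DL _ SD) in TL.
    + move=> i; under eq_bigr do rewrite mulNr.
      by rewrite sumrN -[LHS]opprB; congr (- _); apply/esym; apply: (delta int^o).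
    + under eq_bigr do rewrite scaleNr.
      by rewrite sumrN delta opprB.
  - exists (fun T => be T + ga T); split=> /=.
    + by move=> T TL TD; rewrite addr_ge0 ?b1 ?g1.
    + by move=> T TL; rewrite b2 // g2 // addr0.
    + by move=> i; rewrite b3 g3 -big_split; apply: eq_bigr => T _; rewrite mulrDl.
    + by rewrite b4 g4 -big_split; apply: eq_bigr => T _; rewrite scalerDl.
    + case/orP=> [/b5|/g5] [T [TL TD T0]]; exists T; split=> //.
        by rewrite ltr_wpDr ?g1.
      by rewrite ltr_wpDl ?b1.
  - exists (fun T => m * be T); split=> /=.
    + by move=> T TL TD; rewrite mulr_ge0 ?b1 // ltW.
    + by move=> T TL; rewrite b2 // mulr0.
    + by move=> i; rewrite b3 mulr_sumr; apply: eq_bigr => T _; rewrite mulrA.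
    + by rewrite b4 scaler_sumr; apply: eq_bigr => T _; rewrite scalerA.
    + by move=> /b5[T [TL TD T0]]; exists T; rewrite mulr_gt0.
(* Taking the total weight off at [B0] turns a combination of the differences [a S - a B0] into a
   form in the [a S]. *)
pose al S := be S - (S == B0)%:R * \sum_T be T.
have linE : lin al = - cst r.
  rewrite /lin /al; under eq_bigr do rewrite scalerBl.
  rewrite sumrB [X in _ - X](bigD1 B0) //= eqxx mul1r.
  rewrite [X in _ - (_ + X)]big1 ?addr0 => [|S /negPf ->]; last by rewrite mul0r scale0r.
  rewrite be4; under [in RHS]eq_bigr do rewrite scalerBr.
  by rewrite sumrB -scaler_suml opprB.
exists al => w c DE.
(* The terms in [c] drop out because all coefficients of the certificate vanish. *)
have sc : \sum_S (be S)%:~R * (ev c S - ev c B0) = 0.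
  have evb S : ev c S = \sum_i c 0 i * (b S i)%:~R.
    apply: eq_bigr => i _; rewrite mxE /b; case: (i \in S) => //=.
  under eq_bigr do rewrite !evb -sumrB mulr_sumr.
  rewrite exchange_big /= big1 // => i _.
  transitivity (- (c 0 i * (coef r i)%:~R)); last by rewrite r0 mulr0 oppr0.
  rewrite be3 rmorph_sum mulr_sumr -sumrN; apply: eq_bigr => S _.
  by rewrite rmorphM rmorphB /=; ring.
have linRE : linR al w = \sum_S (be S)%:~R * (w S + ev c S - (w B0 + ev c B0)).
  rewrite -[LHS]addr0 -[X in _ + X = _]sc /linR /al.
  under eq_bigr do rewrite rmorphB rmorphM mulrBl /=.
  rewrite sumrB [X in _ - X](bigD1 B0) //= eqxx mul1r.
  rewrite [X in _ - (_ + X)]big1 ?addr0 => [|S /negPf ->]; last by rewrite !mul0r.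
  rewrite rmorph_sum mulr_suml -sumrB -big_split /=.
  by apply: eq_bigr => S _; ring.
have B0m S : S \in layers k -> w S + ev c S <= w B0 + ev c B0.
  by move: B0D; rewrite DE => /argmaxP[_ H] /H.
have hD S : S \in D -> w S + ev c S = w B0 + ev c B0.
  move=> SD; apply/le_anti/andP; split; first exact/B0m/(subsetP DL).
  by move: SD; rewrite DE => /argmaxP[_]; apply; apply: (subsetP DL).
have ltD S : S \in layers k -> S \notin D -> w S + ev c S < w B0 + ev c B0.
  move=> SL; apply: contraR; rewrite -leNgt => H; rewrite DE; apply/argmaxP; split=> // T TL.
  exact: le_trans (B0m _ TL) H.
have term S : (be S)%:~R * (w S + ev c S - (w B0 + ev c B0)) <= 0.
  have [SL|/be2 ->] := boolP (S \in layers k); last by rewrite mul0r.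
  have [/hD ->|SD] := boolP (S \in D); first by rewrite subrr mulr0.
  by rewrite mulr_ge0_le0 ?subr_le0 ?B0m // ler0z be1.
rewrite linE linRE; case E : (strict r) rn => /= rn.
  left; split; first exact: contrapT.
  have [S [SL SD S0]] := be5 E.
  rewrite (bigD1 S) //=; apply: (@le_lt_trans _ _ ((be S)%:~R * (w S + ev c S - (w B0 + ev c B0)))).
    by rewrite gerDl; apply: sumr_le0 => T _.
  by rewrite pmulr_rlt0 ?ltr0z // subr_lt0 ltD.
right; split; first by rewrite /spos opprK.
by apply: sumr_le0 => S _.
Qed.

Lemma linRD al w w' : linR al (fun S => w S + w' S) = linR al w + linR al w'.
Proof. by rewrite /linR -big_split; apply: eq_bigr => S _; rewrite mulrDr. Qed.

Lemma linRZ al (m : RR) w : linR al (fun S => m * w S) = m * linR al w.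
Proof. by rewrite /linR mulr_sumr; apply: eq_bigr => S _; rewrite mulrCA. Qed.

Definition exchange_form (S T : {set 'I_n}) (y : 'I_n) (U : {set 'I_n}) : int :=
  (U == y |: S)%:R + (U == T :\ y)%:R - (U == S)%:R - (U == T)%:R.

Lemma lin_exchange S T y :
  lin (exchange_form S T y) = a (y |: S) + a (T :\ y) - a S - a T.
Proof.
have delta W : \sum_U ((U == W)%:R : int) *: a U = a W.
  rewrite (bigD1 W) //= eqxx scale1r big1 ?addr0 // => U /negPf ->.
  by rewrite scale0r.
rewrite /lin; under eq_bigr do rewrite !scalerBl scalerDl.
by rewrite !sumrB big_split /= !delta.
Qed.

Lemma linR_exchange S T y w :
  linR (exchange_form S T y) w = w (y |: S) + w (T :\ y) - w S - w T.
Proof.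
have delta W : \sum_U ((U == W)%:R : int)%:~R * w U = w W.
  rewrite (bigD1 W) //= eqxx mul1r big1 ?addr0 // => U /negPf ->.
  by rewrite mul0r.
rewrite /linR /exchange_form; under eq_bigr do rewrite !rmorphB rmorphD /= !mulrBl mulrDl.
by rewrite !sumrB big_split /= !delta.
Qed.

Hypothesis exchange : forall S T : {set 'I_n}, (#|S| < #|T|)%N ->
  exists y, [/\ y \in T, y \notin S & nn (a (y |: S) + a (T :\ y) - a S - a T)].

Lemma initial_subdivision (n_gt0 : (0 < n)%N) : exists Sig : {set {set {set 'I_n}}},
  [/\ subdivision_of_cube RR Sig,
      forall D, D \in Sig -> exists2 k, (k < n)%N & initial_cell k D &
      regular_coarsening_of (fun S => vv (a S)) Sig].
Proof.
have /choice [cert Hcert] : forall p : 'I_n * {set {set 'I_n}}, exists al,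
    p.2 \subset layers p.1 -> p.2 != set0 -> ~ initial_cell p.1 p.2 ->
    forall w c, p.2 = argmax (layers p.1) w c ->
    (nn (lin al) /\ linR al w < 0) \/ (sp (lin al) /\ linR al w <= 0).
  case=> k D /=.
  case: (pselect [/\ D \subset layers k, D != set0 & ~ initial_cell k D]) => [[h1 h2 h3]|H].
    by have [al Hal] := not_initial_cell h1 h2 h3; exists al.
  by exists (fun=> 0) => h1 h2 h3; case: H.
pose La := List.app (List.map cert (enum {: 'I_n * {set {set 'I_n}}}))
  (List.map (fun q : {set 'I_n} * {set 'I_n} * 'I_n => exchange_form q.1.1 q.1.2 q.2)
     (enum {: {set 'I_n} * {set 'I_n} * 'I_n})).
have [u Hu] := real_sign_model La.
have Lcert p : List.In (cert p) La.
  apply/List.in_app_iff; left; apply/List.in_map_iff; exists p; split=> //.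
  by apply/list_InP; rewrite mem_enum.
have Lexch S T y : List.In (exchange_form S T y) La.
  apply/List.in_app_iff; right; apply/List.in_map_iff; exists (S, T, y); split=> //.
  by apply/list_InP; rewrite mem_enum.
pose w S := vv (a S).
pose sq (S : {set 'I_n}) : RR := (#|S|%:R) ^+ 2.
have [N HN] := regular_refine w (fun S => u S - sq S).
pose w1 S := N%:R * w S + u S.
pose w2 S := N%:R * w S + (u S - sq S).
have w1lin al : linR al w1 = N%:R * vv (lin al) + linR al u.
  by rewrite linRD linRZ linR_vv.
have w1nn al : List.In al La -> nn (lin al) -> 0 <= linR al w1.
  move=> /Hu[H _] h; rewrite w1lin addr_ge0 ?H // mulr_ge0 ?ler0n //; exact: vv_ge0.
have w1sp al : List.In al La -> sp (lin al) -> 0 < linR al w1.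
  move=> /Hu[_ H] h; rewrite w1lin ltr_wpDl ?H // mulr_ge0 ?ler0n //; apply: vv_ge0.
  exact: (sp_nn nnP).
exists (regular_cells w2); split; first exact: regular_subdivision.
- move=> D /regular_cellsP[c DE].
  have Dm S T : S \in D -> w2 T + ev c T <= w2 S + ev c S.
    by rewrite DE => /argmaxP[_]; apply; rewrite in_setT.
  (* If the sizes differed by 2 or more, moving [y] from [T] to [S] would preserve the linear part,
     not decrease [w1], and strictly decrease the sum of squared sizes: one of the new sets would
     exceed the maximum. *)
  have sizes S T : S \in D -> T \in D -> (#|T| <= #|S|.+1)%N.
    move=> SD TD; rewrite leqNgt; apply/negP => lt2.
    have [y [yT yS /= Hy]] := exchange (ltnW lt2).
    have := w1nn _ (Lexch S T y); rewrite lin_exchange => /(_ Hy).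
    rewrite linR_exchange.
    have := Dm _ (y |: S) SD; have := Dm _ (T :\ y) TD.
    rewrite !ev_sum big_setU1 //= (big_setD1 y yT) /= /w2.
    have s1 : sq (y |: S) = (#|S|%:R + 1) ^+ 2.
      by rewrite /sq cardsU1 yS natrD addrC.
    have s2 : sq T = (#|T :\ y|%:R + 1) ^+ 2.
      by rewrite /sq (cardsD1 y T) yT natrD addrC.
    have lt3 : #|S|%:R + 1 <= #|T :\ y|%:R :> RR.
      have -> : #|S|%:R + 1 = #|S|.+1%:R :> RR by rewrite -natr1.
      by rewrite ler_nat; move: lt2; rewrite (cardsD1 y T) yT.
    have s3 : sq S = #|S|%:R ^+ 2 by [].
    have s4 : sq (T :\ y) = #|T :\ y|%:R ^+ 2 by [].
    rewrite s1 s2 s3 s4 /w1 => h1 h2 h3; clear DE; lra.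
  have Dn0 : D != set0 by rewrite DE argmax_neq0 //; apply/set0Pn; exists set0.
  have [k kn DL] : exists2 k, (k < n)%N & D \subset layers k.
    have /set0Pn[S1 S1D] := Dn0.
    have [S SD Smin] := @arg_minnP _ S1 (mem D) (fun S => #|S|) S1D.
    have [lt|ge] := ltnP #|S| n.
      exists #|S| => //; apply/subsetP => T TD; rewrite inE.
      have h1 := sizes _ _ SD TD; have h2 : (#|S| <= #|T|)%N by apply: Smin.
      by move: h1; rewrite leq_eqVlt ltnS => /orP[->|h1]; rewrite ?orbT // eqn_leq h1 h2.
    (* All members of [D] have size [n], but the layer index must stay below [n]: they form the
       upper layer of [n - 1]. *)
    exists n.-1; first by rewrite prednK.
    apply/subsetP => T TD; rewrite inE prednK //.
    have h2 : (n <= #|T|)%N by apply: leq_trans ge _; apply: Smin.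
    by rewrite [X in _ || X]eqn_leq h2 andbT -[X in (_ <= X)%N](card_ord n) max_card orbT.
  exists k => //; apply: contrapT => nI.
  (* For sizes [k] and [k + 1] the square [|S|^2] equals [(2k + 1)|S| - k(k + 1)], so it is affine
     there and moves into the functional. *)
  pose c1 := c - \row_(i < n) (2 * k + 1)%:R.
  have w12 S : S \in layers k -> w2 S + ev c S = w1 S + ev c1 S + (k * k.+1)%:R.
    rewrite inE => HS; rewrite /w2 /w1 /c1 dotDl dotNl.
    have -> : ev (\row__ (2 * k + 1)%:R) S = (#|S| * (2 * k + 1))%:R :> RR.
      rewrite ev_sum (eq_bigr (fun=> (2 * k + 1)%:R)) => [|i _]; last by rewrite mxE.
      by rewrite sumr_const natrM -[LHS]mulr_natr mulrC.
    rewrite /sq; case/orP: HS => /eqP ->; rewrite !(natrM, natrD, =^~ natr1); ring.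
  have DE1 : D = argmax (layers k) w1 c1.
    apply/setP => S; apply/idP/argmaxP => [SD|[SL HS]].
      have SL := subsetP DL _ SD; split=> // T TL.
      by have := Dm _ T SD; rewrite !w12 // lerD2r.
    rewrite DE; apply/argmaxP; split=> [|T _]; first by rewrite in_setT.
    have /set0Pn[S1 S1D] := Dn0; have S1L := subsetP DL _ S1D.
    apply: le_trans (Dm _ _ S1D) _.
    by rewrite (w12 _ SL) (w12 _ S1L) lerD2r HS.
  have [[h1 h2]|[h1 h2]] := Hcert (Ordinal kn, D) DL Dn0 nI w1 c1 DE1.
    by have := w1nn _ (Lcert _) h1; rewrite leNgt h2.
  by have := w1sp _ (Lcert _) h1; rewrite ltNge h2.
- move=> P [c HP].
  exists [set D in regular_cells w2 | D \subset argmax setT w c].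
    by apply/subsetP => D; rewrite inE => /andP[].
  move=> x; rewrite HP upper_faceE; split=> [/HN[c' [sub Hx]]|[D]].
    exists (argmax setT w2 c') => //; rewrite inE sub andbT.
    by apply/regular_cellsP; exists c'.
  by rewrite inE => /andP[_ sub]; apply: conv_sub.
Qed.

End Combinatorics.

(** * Archimedean domination and standard parts *)

Section ArchimedeanDomination.
Variable K : numFieldType.
Implicit Types x y z : K.

(** Domination up to a natural factor: [arch_le x 1] says that [x] is finite, [arch_le 1 x] that it
    is not infinitesimal. *)
Definition arch_le x y := exists N : nat, `|x| <= N%:R * `|y|.

Lemma arch_le_refl x : arch_le x x.
Proof. by exists 1%N; rewrite mul1r. Qed.

Lemma arch_le_trans y x z : arch_le x y -> arch_le y z -> arch_le x z.
Proof.
case=> N HN [M HM]; exists (N * M)%N; rewrite natrM -mulrA.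
by apply: le_trans HN _; rewrite ler_wpM2l // ler0n.
Qed.

Lemma arch_leM x y z t : arch_le x y -> arch_le z t -> arch_le (x * z) (y * t).
Proof.
case=> N HN [M HM]; exists (N * M)%N; rewrite natrM !normrM mulrACA.
by apply: ler_pM.
Qed.

Lemma arch_leX m x y : arch_le x y -> arch_le (x ^+ m) (y ^+ m).
Proof. by move=> H; elim: m => [|m IH]; [exact: arch_le_refl | rewrite !exprS; apply: arch_leM]. Qed.

Lemma arch_le0 y : arch_le 0 y.
Proof. by exists 0%N; rewrite mul0r normr0. Qed.

Lemma arch_le_eq0 x : arch_le x 0 -> x = 0.
Proof. by case=> N; rewrite normr0 mulr0 normr_le0 => /eqP. Qed.

Lemma arch_leD x y z : arch_le x z -> arch_le y z -> arch_le (x + y) z.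
Proof.
case=> N HN [M HM]; exists (N + M)%N; rewrite natrD mulrDl.
by apply: le_trans (ler_normD _ _) (lerD HN HM).
Qed.

Lemma arch_leN x z : arch_le x z -> arch_le (- x) z.
Proof. by case=> N HN; exists N; rewrite normrN. Qed.

Lemma arch_le_sum (I : Type) (r : seq I) (P : pred I) (f : I -> K) z :
  (forall i, P i -> arch_le (f i) z) -> arch_le (\sum_(i <- r | P i) f i) z.
Proof. by move=> H; apply: (big_ind (fun x => arch_le x z)) => //; [exact: arch_le0 | move=> x y; apply: arch_leD]. Qed.

Lemma arch_le_total x y : arch_le x y \/ arch_le y x.
Proof.
have /orP[H|H] := real_leVge (normr_real x) (normr_real y); [left|right];
  by exists 1%N; rewrite mul1r.
Qed.

Lemma arch_le_pM2r t x y : t != 0 -> arch_le (x * t) (y * t) -> arch_le x y.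
Proof.
move=> t0 H; rewrite -[x](mulfK t0) -[y](mulfK t0); apply: arch_leM => //; exact: arch_le_refl.
Qed.

Lemma arch_le_sum_exists (I : finType) (f : I -> K) : \sum_i f i != 0 ->
  exists i, arch_le (\sum_j f j) (f i).
Proof.
move=> s0.
have tr (y x z : I) : arch_le (f x) (f y) -> arch_le (f y) (f z) -> arch_le (f x) (f z).
  exact: arch_le_trans.
have [e0|[m _ Hm]] := total_has_max (fun i j => arch_le_total (f i) (f j)) tr (enum I).
  case/eqP: s0; apply: big1 => i _.
  by have := mem_enum I i; rewrite e0.
by exists m; apply: arch_le_sum => i _; apply: Hm; apply/list_InP; rewrite mem_enum.
Qed.

Definition fin x := arch_le x 1.

Lemma fin1 : fin 1. Proof. exact: arch_le_refl. Qed.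

Lemma finM x y : fin x -> fin y -> fin (x * y).
Proof. by move=> h1 h2; rewrite /fin -[1]mulr1; apply: arch_leM. Qed.

Lemma ge1M x y : arch_le 1 x -> arch_le 1 y -> arch_le 1 (x * y).
Proof. by move=> h1 h2; rewrite -[1]mulr1; apply: arch_leM. Qed.

Lemma fin_prod (I : Type) (r : seq I) (P : pred I) (f : I -> K) :
  (forall i, P i -> fin (f i)) -> fin (\prod_(i <- r | P i) f i).
Proof. by move=> H; apply: (big_ind fin) => //; [exact: fin1 | move=> x y; apply: finM]. Qed.

Lemma fin_nat (m : nat) : fin m%:R.
Proof. by exists m; rewrite normr1 mulr1 ger0_norm ?ler0n. Qed.

Lemma fin_int (m : int) : fin m%:~R.
Proof. by case: m => m; rewrite ?NegzE ?mulrNz; [|apply: arch_leN]; apply: fin_nat. Qed.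

Definition finmx m n (M : 'M[K]_(m, n)) := forall i j, fin (M i j).

Lemma fin_det n (M : 'M[K]_n) : finmx M -> fin (\det M).
Proof.
move=> H; apply: arch_le_sum => s _; apply: finM; last by apply: fin_prod => i _.
by case: (odd_perm s); rewrite ?expr1 ?expr0; [apply: arch_leN|]; apply: arch_le_refl.
Qed.

Lemma fin_mulmx m n p (M : 'M[K]_(m, n)) (N : 'M[K]_(n, p)) :
  finmx M -> finmx N -> finmx (M *m N).
Proof. by move=> h1 h2 i j; rewrite mxE; apply: arch_le_sum => k _; apply: finM. Qed.

End ArchimedeanDomination.

(* The standard part of a place from [K] to [F] whose valuation ring consists
   of the finite elements of [K]. *)
Record standard_part (K F : numFieldType) (st : K -> F) : Prop := StandardPart {
  st1 : st 1 = 1;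
  stD : forall x y, fin x -> fin y -> st (x + y) = st x + st y;
  stM : forall x y, fin x -> fin y -> st (x * y) = st x * st y;
  st_neq0 : forall x, fin x -> (st x != 0 <-> arch_le 1 x) }.

Section StandardPart.
Variables (K F : numFieldType) (st : K -> F).
Hypothesis stP : standard_part st.

Lemma st0 : st 0 = 0.
Proof.
have f0 : fin (0 : K) by exact: arch_le0.
by have := stD stP f0 f0; rewrite addr0 -{1}[st 0]addr0 => /addrI.
Qed.

Lemma stN x : fin x -> st (- x) = - st x.
Proof.
by move=> fx; apply/eqP; rewrite -addr_eq0 -(stD stP (arch_leN fx) fx) addNr st0.
Qed.

Lemma st_sum (I : Type) (r : seq I) (P : pred I) (f : I -> K) :
  (forall i, P i -> fin (f i)) -> st (\sum_(i <- r | P i) f i) = \sum_(i <- r | P i) st (f i).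
Proof.
move=> H.
suff [] : fin (\sum_(i <- r | P i) f i) /\
    st (\sum_(i <- r | P i) f i) = \sum_(i <- r | P i) st (f i) by [].
elim/big_rec2: _ => [|i y x Pi [fx <-]]; first by rewrite st0; split=> //; apply: arch_le0.
by rewrite (stD stP (H _ Pi) fx); split=> //; apply: arch_leD => //; apply: H.
Qed.

Lemma st_prod (I : Type) (r : seq I) (P : pred I) (f : I -> K) :
  (forall i, P i -> fin (f i)) -> st (\prod_(i <- r | P i) f i) = \prod_(i <- r | P i) st (f i).
Proof.
move=> H.
suff [] : fin (\prod_(i <- r | P i) f i) /\
    st (\prod_(i <- r | P i) f i) = \prod_(i <- r | P i) st (f i) by [].
elim/big_rec2: _ => [|i y x Pi [fx <-]]; first by rewrite (st1 stP); split=> //; apply: fin1.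
by rewrite (stM stP (H _ Pi) fx); split=> //; apply: finM => //; apply: H.
Qed.

Lemma st_nat (m : nat) : st m%:R = m%:R.
Proof.
elim: m => [|m IH]; first exact: st0.
by rewrite -!natr1 (stD stP (fin_nat _ _) (fin1 _)) IH (st1 stP).
Qed.

Lemma st_int (m : int) : st m%:~R = m%:~R.
Proof.
case: m => m; first exact: st_nat.
by rewrite NegzE !mulrNz (stN (fin_nat _ _)) st_nat.
Qed.

Lemma st_det n (M : 'M[K]_n) : finmx M -> st (\det M) = \det (map_mx st M).
Proof.
move=> H; rewrite /determinant st_sum => [|s _].
  apply: eq_bigr => s _; rewrite (stM stP).
  - rewrite st_prod => [|i _]; last exact: H.
    congr (_ * _); last by apply: eq_bigr => i _; rewrite mxE.
    by case: (odd_perm s); rewrite ?expr1 ?expr0 ?(stN (fin1 _)) ?(st1 stP).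
  - by case: (odd_perm s); rewrite ?expr1 ?expr0; [apply: arch_leN|]; apply: arch_le_refl.
  - by apply: fin_prod => i _.
apply: finM; last by apply: fin_prod => i _.
by case: (odd_perm s); rewrite ?expr1 ?expr0; [apply: arch_leN|]; apply: arch_le_refl.
Qed.

Lemma st_mulmx m n p (M : 'M[K]_(m, n)) (N : 'M[K]_(n, p)) :
  finmx M -> finmx N -> map_mx st (M *m N) = map_mx st M *m map_mx st N.
Proof.
move=> h1 h2; apply/matrixP => i j; rewrite !mxE st_sum => [|k _]; last exact: finM.
by apply: eq_bigr => k _; rewrite !mxE (stM stP).
Qed.

End StandardPart.

(** * Reindexing and normalization of minors *)

Section Reindexing.
Variable R : comNzRingType.

Lemma same_range_perm (T : finType) k (g h : 'I_k -> T) (S : {set T}) :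
  injective g -> injective h -> (forall i, g i \in S) -> (forall i, h i \in S) ->
  #|S| = k -> exists s : 'S_k, forall i, h i = g (s i).
Proof.
move=> gi hi gS hS Sk.
have imE : g @: [set: 'I_k] = S.
  apply/eqP; rewrite eqEcard card_imset // cardsT card_ord Sk leqnn andbT.
  by apply/subsetP => _ /imsetP[i _ ->].
have /choice[t Ht] : forall i, exists j, h i = g j.
  by move=> i; have := hS i; rewrite -imE => /imsetP[j _ ->]; exists j.
have ti : injective t by move=> i j E; apply: hi; rewrite !Ht E.
by exists (perm ti) => i; rewrite permE.
Qed.

Lemma det_colsub_perm k n (M : 'M[R]_(k, n)) (g : 'I_k -> 'I_n) (s : 'S_k) :
  \det (colsub (g \o s) M) = (-1) ^+ s * \det (colsub g M).
Proof.
have -> : colsub (g \o s) M = col_perm s (colsub g M).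
  by apply/matrixP => i j; rewrite !mxE.
by rewrite col_permE det_mulmx det_perm odd_permV mulrC.
Qed.

Lemma det_rowsub_perm k n (M : 'M[R]_(n, k)) (g : 'I_k -> 'I_n) (s : 'S_k) :
  \det (rowsub (g \o s) M) = (-1) ^+ s * \det (rowsub g M).
Proof.
have -> : rowsub (g \o s) M = row_perm s (rowsub g M).
  by apply/matrixP => i j; rewrite !mxE.
by rewrite row_permE det_mulmx det_perm.
Qed.

Lemma mxsub_rowcol m n m' n' (f : 'I_m' -> 'I_m) (g : 'I_n' -> 'I_n) (A : 'M[R]_(m, n)) :
  mxsub f g A = colsub g (rowsub f A).
Proof. by apply/matrixP => i j; rewrite !mxE. Qed.

Lemma mxsub_colrow m n m' n' (f : 'I_m' -> 'I_m) (g : 'I_n' -> 'I_n) (A : 'M[R]_(m, n)) :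
  mxsub f g A = rowsub f (colsub g A).
Proof. by apply/matrixP => i j; rewrite !mxE. Qed.

(** Frees minors from the enumeration of [S]: rows and columns are permuted alike, so the sign is
    squared. *)
Lemma pminor_det n (A : 'M[R]_n) k (g : 'I_k -> 'I_n) (S : {set 'I_n}) :
  injective g -> (forall i, g i \in S) -> #|S| = k -> pminor A S = \det (mxsub g g A).
Proof.
move=> gi gS Sk; subst k.
have [s Hs] := same_range_perm gi (@enum_val_inj _ (mem S)) gS (@enum_valP _ (mem S)) erefl.
have -> : pminor A S = \det (mxsub (g \o s) (g \o s) A).
  by congr (\det _); apply/matrixP => i j; rewrite !mxE /= -!Hs.
rewrite mxsub_rowcol det_colsub_perm -mxsub_rowcol mxsub_colrow det_rowsub_perm.
by rewrite -mxsub_colrow mulrA -expr2 sqrr_sign mul1r.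
Qed.

(** Cofactors along row [j] ignore that row, so they are those of the identity matrix. Each entry of
    a normalized matrix is thus itself a maximal minor. *)
Lemma det_replace_row n k (Y : 'M[R]_(n, k)) (f : 'I_k -> 'I_n) (i : 'I_n) (j : 'I_k) :
  rowsub f Y = 1%:M ->
  \det (rowsub (fun l => if l == j then i else f l) Y) = Y i j.
Proof.
move=> fY; set M := rowsub _ Y.
have cof c : cofactor M j c = (\adj (1%:M : 'M[R]_k)) c j.
  rewrite mxE /cofactor; congr (_ * \det _).
  apply/matrixP => a b; rewrite -fY !mxE.
  by rewrite eq_sym (negPf (neq_lift _ _)).
rewrite (expand_det_row _ j); under eq_bigr do rewrite cof.
have adj1 : \adj (1%:M : 'M[R]_k) = 1%:M.
  by rewrite -[LHS]mulmx1 mul_adj_mx det1.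
rewrite adj1 (bigD1 j) //= !mxE !eqxx mulr1 big1 ?addr0 // => c /negPf cj.
by rewrite !mxE cj mulr0.
Qed.

Lemma det_rowsub_noninj n k (Z : 'M[R]_(n, k)) (f : 'I_k -> 'I_n) :
  ~ injective f -> \det (rowsub f Z) = 0.
Proof.
move=> nf; apply: contrapT => d0; apply: nf => i j E.
apply/eqP; apply: contrapT => /negP ij; apply: d0.
by apply: (determinant_alternate ij) => l; rewrite !mxE E.
Qed.

End Reindexing.

Section MaximalMinor.
Variable K : numFieldType.

(** Every entry of [Y] is a maximal minor of [Z] divided by the dominating one. *)
Lemma maximal_minor_basis n k (Z : 'M[K]_(n, k)) (f : 'I_k -> 'I_n) :
  \det (rowsub f Z) != 0 ->
  (forall f' : 'I_k -> 'I_n, arch_le (\det (rowsub f' Z)) (\det (rowsub f Z))) ->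
  let Y := Z *m invmx (rowsub f Z) in
  [/\ Z = Y *m rowsub f Z, rowsub f Y = 1%:M & finmx Y].
Proof.
move=> d0 Hf Y.
have un : rowsub f Z \in unitmx by rewrite unitmxE unitfE.
have ZE : Z = Y *m rowsub f Z by rewrite /Y mulmxKV.
have Y1 : rowsub f Y = 1%:M by rewrite -mul_rowsub_mx mulmxV.
split=> // i j; rewrite -(det_replace_row i j Y1).
apply: (arch_le_pM2r d0); rewrite mul1r -det_mulmx mul_rowsub_mx -ZE.
exact: Hf.
Qed.

Lemma exists_maximal_minor n k (Z : 'M[K]_(n, k)) : row_full Z ->
  exists f : 'I_k -> 'I_n, \det (rowsub f Z) != 0 /\
  forall f' : 'I_k -> 'I_n, arch_le (\det (rowsub f' Z)) (\det (rowsub f Z)).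
Proof.
move=> Zf; pose D (f : {ffun 'I_k -> 'I_n}) := \det (rowsub f Z).
have tr (y x z : {ffun 'I_k -> 'I_n}) : arch_le (D x) (D y) -> arch_le (D y) (D z) -> arch_le (D x) (D z).
  exact: arch_le_trans.
have [e0|[m _ Hm]] := total_has_max (fun x y => arch_le_total (D x) (D y)) tr (enum {ffun 'I_k -> 'I_n}).
  by have := mem_enum {ffun 'I_k -> 'I_n} (fullrankfun Zf); rewrite e0.
have Hm' f : arch_le (\det (rowsub f Z)) (D m).
  have -> : rowsub f Z = rowsub [ffun i => f i] Z by apply/matrixP => i j; rewrite !mxE ffunE.
  by apply: Hm; apply/list_InP; rewrite mem_enum.
exists m; split=> //; apply/eqP => Dm0.
have := Hm' (fullrankfun Zf); rewrite /D Dm0 => /arch_le_eq0 /eqP.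
by have := fullrowsub_unit Zf; rewrite unitmxE unitfE => /negPf ->.
Qed.

End MaximalMinor.

(** * Conjugate transposes, Gram determinants and Cholesky factors *)

Section Conjugation.
Variables (K : numFieldType) (cj : {rmorphism K -> K}).
Hypothesis cjP : forall x, x * cj x = `|x| ^+ 2.

(** The conjugate transpose; [cj] will be the identity or complex conjugation, so that one proof
    covers both cases. *)
Definition adjm m n (M : 'M[K]_(m, n)) : 'M[K]_(n, m) := map_mx cj M^T.

Lemma adjmM m n p (M : 'M[K]_(m, n)) (N : 'M[K]_(n, p)) : adjm (M *m N) = adjm N *m adjm M.
Proof. by rewrite /adjm trmx_mul map_mxM. Qed.

Lemma adjm1 n : adjm (1%:M : 'M[K]_n) = 1%:M.
Proof. by rewrite /adjm trmx1 map_mx1. Qed.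

Lemma det_adjm n (M : 'M[K]_n) : \det (adjm M) = cj (\det M).
Proof. by rewrite /adjm det_map_mx det_tr. Qed.

Lemma cj_real x : 0 <= x -> cj x = x.
Proof.
move=> x0; have [->|n0] := eqVneq x 0; first by rewrite rmorph0.
by apply: (mulfI n0); rewrite cjP ger0_norm.
Qed.

Lemma cjK x : cj (cj x) = x.
Proof.
have [->|n0] := eqVneq x 0; first by rewrite !rmorph0.
have c0 : cj x != 0 by rewrite fmorph_eq0.
apply: (mulfI c0); rewrite -rmorphM /= [RHS]mulrC cjP cj_real // exprn_ge0 //.
Qed.

Lemma norm_cj x : `|cj x| = `|x|.
Proof.
apply/eqP; rewrite -(@eqrXn2 _ 2) // -!cjP cjK mulrC //.
Qed.

Lemma adjmK m n (M : 'M[K]_(m, n)) : adjm (adjm M) = M.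
Proof. by apply/matrixP => i j; rewrite !mxE cjK. Qed.

Lemma fin_adjm m n (M : 'M[K]_(m, n)) : finmx M -> finmx (adjm M).
Proof. by move=> H i j; rewrite !mxE; have [N HN] := H j i; exists N; rewrite norm_cj. Qed.

Lemma gram_eq0 m (v : 'rV[K]_m) : v *m adjm v = 0 -> v = 0.
Proof.
move=> H; have := congr1 (fun M : 'M_1 => M 0 0) H; rewrite !mxE => /eqP.
under eq_bigr do rewrite !mxE cjP.
rewrite psumr_eq0 => [|i _]; last by rewrite exprn_ge0.
move=> /allP H0; apply/rowP => i; rewrite mxE.
by have := H0 i (mem_index_enum _); rewrite expf_eq0 /= normr_eq0 => /eqP.
Qed.

(* The kernel of [y^* y] is that of [y], which is injective. *)
Lemma det_gram_neq0 n k (y : 'M[K]_(n, k)) (f : 'I_k -> 'I_n) : rowsub f y = 1%:M ->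
  \det (adjm y *m y) != 0.
Proof.
move=> fy; apply/negP => /det0P[v v0 Hv].
case/eqP: v0.
have v1 : v *m adjm y = 0.
  by apply: gram_eq0; rewrite adjmM adjmK -mulmxA [_ *m (y *m _)]mulmxA mulmxA Hv mul0mx.
have : adjm (rowsub f y) = colsub f (adjm y) by apply/matrixP => i j; rewrite !mxE.
rewrite fy adjm1 => E; rewrite -[v]mulmx1 E mulmx_colsub v1.
by apply/matrixP => i j; rewrite !mxE.
Qed.

Hypothesis rootP : forall x : K, 0 < x -> forall m, (0 < m)%N -> exists2 y, 0 < y & y ^+ m = x.

(** The leading block factors by induction, the last column [u] solves a linear system, and the
    Schur complement [dl] is positive as a quotient of consecutive leading minors, hence a
    square. *)
Lemma cholesky n (A : 'M[K]_n) : A^T = map_mx cj A ->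
  (forall k (h : (k <= n)%N), 0 < \det (mxsub (widen_ord h) (widen_ord h) A)) ->
  exists U : 'M[K]_n, A = adjm U *m U.
Proof.
elim: n A => [|n IH] A.
  by move=> _ _; exists 1%:M; apply/matrixP => -[].
move: A; rewrite -addn1 => A Ah Apos.
have [|k h|U HU] := IH (ulsubmx A).
- by rewrite trmx_ulsub Ah map_ulsubmx.
- have h' : (k <= n + 1)%N by rewrite addn1 leqW.
  have := Apos k h'; congr (0 < \det _); apply/matrixP => i j; rewrite !mxE.
  by congr (A _ _); apply/val_inj.
have dU : 0 < \det (ulsubmx A).
  have h' : (n <= n + 1)%N by rewrite addn1.
  have := Apos n h'; congr (0 < \det _); apply/matrixP => i j; rewrite !mxE.
  by congr (A _ _); apply/val_inj.
have Uun : adjm U \in unitmx.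
  rewrite unitmxE unitfE; apply/negP => /eqP d0; move: dU.
  by rewrite HU det_mulmx d0 mul0r ltxx.
set b := ursubmx A; set u := invmx (adjm U) *m b.
have bE : adjm U *m u = b by rewrite mulKVmx.
have bE' : adjm u *m U = dlsubmx A.
  rewrite -[U in LHS]adjmK -adjmM bE /adjm -map_trmx /b -[A in LHS]trmxK Ah.
  by apply/matrixP => i j; rewrite !mxE cjK.
set dl := drsubmx A 0 0 - (adjm u *m u) 0 0.
have AE : A = block_mx (adjm U) 0 (adjm u) 1%:M *m block_mx U u 0 dl%:M.
  rewrite mulmx_block !mul0mx !mulmx0 !addr0 mul1mx -HU bE bE'.
  rewrite -[LHS]submxK; congr block_mx.
  by apply/matrixP => i j; rewrite !ord1 !mxE eqxx mulr1n /dl addrC !mxE subrK.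
have dA : 0 < \det A.
  by have := Apos _ (leqnn _); congr (0 < \det _); apply/matrixP => i j; rewrite !mxE;
     congr (A _ _); apply/val_inj.
have dlpos : 0 < dl.
  move: dA; rewrite {1}AE det_mulmx det_lblock det_ublock det1 mulr1 mulrA -det_mulmx -HU.
  by rewrite det_scalar1 pmulr_rgt0.
have [s s0 s2] := rootP dlpos (isT : 0 < 2)%N.
exists (block_mx U u 0 s%:M).
have -> : adjm (block_mx U u 0 s%:M) = block_mx (adjm U) 0 (adjm u) s%:M.
  rewrite /adjm tr_block_mx map_block_mx trmx0 map_mx0 tr_scalar_mx map_scalar_mx cj_real //.
  exact: ltW.
rewrite {1}AE !mulmx_block !mul0mx !mulmx0 !addr0 mul1mx.
by rewrite -scalar_mxM -expr2 s2.
Qed.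

End Conjugation.

(** * Generic integer matrices and flag minors *)

Section GenericIntegerMatrix.
Variables (F : numFieldType) (n : nat).

(** Polynomiality is asked only along integral lines, which is enough to avoid finitely many zero
    sets. *)
Definition poly_on_lines (P : 'M[int]_n -> F) :=
  forall a b, exists q : {poly F}, forall t : nat, P (a + b *+ t) = q.[t%:R].

Lemma nat_nonroot (q : {poly F}) : q != 0 -> exists t : nat, q.[t%:R] != 0.
Proof.
move=> q0; apply: contrapT => H.
have := @max_poly_roots F q [seq t%:R | t <- iota 0 (size q)] q0.
rewrite size_map size_iota ltnn => Hm; suff : false by []; apply: Hm.
  apply/allP => _ /mapP[t _ ->]; rewrite rootE; apply/negP => /negP nz.
  by apply: H; exists t.
rewrite map_inj_uniq ?iota_uniq // => i j /eqP.
by rewrite eqr_nat => /eqP.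
Qed.

(** Join a matrix good for the other conditions to one good for [P i]. On this line no polynomial is
    zero, by its value at 0 or at 1, so their product has a natural nonroot. *)
Lemma generic_int_matrix (I : finType) (P : I -> 'M[int]_n -> F) :
  (forall i, poly_on_lines (P i)) -> (forall i, exists G, P i G != 0) ->
  exists G, forall i, P i G != 0.
Proof.
move=> Pl Pn.
suff [G HG] : exists G, forall i, i \in enum I -> P i G != 0.
  by exists G => i; apply: HG; rewrite mem_enum.
elim: (enum I) => [|i s [G HG]]; first by exists 0.
have [Gi HGi] := Pn i.
have /choice [q Hq] : forall j, exists q : {poly F}, forall t : nat,
    P j (G + (Gi - G) *+ t) = q.[t%:R].
  by move=> j; apply: Pl.
have qi0 : q i != 0.
  by apply: contraNneq HGi => q0; have := Hq i 1%N; rewrite q0 horner0 mulr1n addrC subrK => ->.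
have qs0 j : j \in s -> q j != 0.
  move=> /HG; apply: contraNneq => q0.
  by have := Hq j 0%N; rewrite q0 horner0 mulr0n addr0 => ->.
have qall : \prod_(j <- i :: s) q j != 0.
  by rewrite prodf_seq_neq0 /= qi0 /=; apply/allP => j /qs0.
have [t Ht] := nat_nonroot qall.
exists (G + (Gi - G) *+ t) => j js; rewrite Hq.
move: Ht; rewrite horner_prod prodf_seq_neq0 => /allP /(_ _ js).
by [].
Qed.

Lemma poly_on_lines_det k (f : 'I_k -> 'I_n) (y : 'M[F]_(n, k)) :
  poly_on_lines (fun G => \det (rowsub f (map_mx intr G) *m y)).
Proof.
move=> a b.
pose L (G : 'M[int]_n) := map_mx polyC (rowsub f (map_mx intr G) *m y).
exists (\det (L a + 'X *: L b)) => t.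
rewrite -/(horner_eval t%:R _) -det_map_mx; congr (\det _).
apply/matrixP => i j; rewrite !mxE /= /horner_eval !hornerE.
rewrite mulr_sumr -big_split; apply: eq_bigr => l _; rewrite !mxE /=.
by rewrite rmorphD mulmxnE /= [X in (_ + X) * _]raddfMn -mulr_natl; ring.
Qed.

End GenericIntegerMatrix.

Section FlagMatrix.
Variables (K F : numFieldType) (cj : {rmorphism K -> K}) (cjF : {rmorphism F -> F}).
Hypothesis cjP : forall x, x * cj x = `|x| ^+ 2.
Hypothesis cjFP : forall x, x * cjF x = `|x| ^+ 2.
Hypothesis rootP : forall x : K, 0 < x -> forall m, (0 < m)%N -> exists2 y, 0 < y & y ^+ m = x.
Variable st : K -> F.
Hypothesis stP : standard_part st.
Hypothesis st_cj : forall x, fin x -> st (cj x) = cjF (st x).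
Variable n : nat.

Local Notation "M '^*m'" := (adjm cj M) (at level 8).

(** With [Z = Y Z0] normalized, the principal minor is [cj (det Z0) * det Z0] times the Gram
    determinant of [Y], a finite unit, and minors of [X] are [det Z0] times the finite determinant
    of rows of [G] times [Y]. For the top rows the latter has standard part [P G]. *)
Lemma generic_flag_minor (U : 'M[K]_n) k (g : 'I_k -> 'I_n) :
  \det (mxsub g g (adjm cj U *m U)) != 0 ->
  exists P : 'M[int]_n -> F, [/\ poly_on_lines P, exists G, P G != 0 &
    forall G, let X := map_mx (intr : int -> K) G *m U in
      (forall f : 'I_k -> 'I_n, arch_le (\det (mxsub f g X) ^+ 2) (\det (mxsub g g (adjm cj U *m U)))) /\
      (P G != 0 -> forall h : (k <= n)%N,
        arch_le (\det (mxsub g g (adjm cj U *m U))) (\det (mxsub (widen_ord h) g X) ^+ 2))].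
Proof.
set Z := colsub g U.
have AE : mxsub g g (adjm cj U *m U) = adjm cj Z *m Z.
  by rewrite mxsub_mul; congr (_ *m _); apply/matrixP => i j; rewrite !mxE.
rewrite AE => dA.
have Zf : row_full Z.
  rewrite -col_leq_rank; apply: leq_trans (mxrankM_maxr (adjm cj Z) Z).
  by rewrite mxrank_unit // unitmxE unitfE.
have [f [d0 Hf]] := exists_maximal_minor Zf.
have [] := maximal_minor_basis d0 Hf.
set Y := Z *m _; set Z0 := rowsub f Z in d0 *; move=> ZE Y1 Yfin.
clearbody Y Z0.
pose y := map_mx st Y.
have y1 : rowsub f y = 1%:M.
  have -> : rowsub f y = map_mx st (rowsub f Y) by apply/matrixP => i j; rewrite !mxE.
  rewrite Y1; apply/matrixP => i j; rewrite !mxE.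
  by case: eqP => _ /=; rewrite ?(st1 stP) ?(st0 stP).
have gramE : \det (adjm cj Z *m Z) = cj (\det Z0) * \det Z0 * \det (adjm cj Y *m Y).
  rewrite [in LHS]ZE adjmM -mulmxA [adjm _ Y *m _]mulmxA !det_mulmx det_adjm; ring.
have fgram : finmx (adjm cj Y *m Y) by apply: fin_mulmx => //; apply: fin_adjm.
have gram_unit : arch_le 1 (\det (adjm cj Y *m Y)).
  apply/(st_neq0 stP); first exact: fin_det.
  rewrite (st_det stP) // (st_mulmx stP) //; last exact: fin_adjm.
  have -> : map_mx st (adjm cj Y) = adjm cjF y.
    by apply/matrixP => i j; rewrite !mxE (st_cj (Yfin _ _)).
  exact: (det_gram_neq0 cjFP y1).
have cjd : arch_le (cj (\det Z0) * \det Z0) (\det Z0 ^+ 2) /\ arch_le (\det Z0 ^+ 2) (cj (\det Z0) * \det Z0).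
  by split; exists 1%N; rewrite mul1r expr2 !normrM (norm_cj cjP).
have fG (G : 'M[int]_n) k' (f' : 'I_k' -> 'I_n) : finmx (rowsub f' (map_mx (intr : int -> K) G)).
  by move=> i j; rewrite !mxE; apply: fin_int.
(* For [k <= n], which the full column rank of [Z] forces, the selected row is [i] itself; the
   default [f i] is never reached. *)
exists (fun G => \det (rowsub (fun i : 'I_k => if insub (val i) is Some j then j else f i)
   (map_mx (intr : int -> F) G) *m y)); split.
- exact: poly_on_lines_det.
- have [kn|nk] := leqP k n; last first.
    have := rank_leq_row Z; rewrite leqNgt => /negP [].
    by move: Zf; rewrite /row_full => /eqP ->.
  (* This [G] brings the rows [f] to the top, and [y] is the identity on them. *)
  pose G : 'M[int]_n := \matrix_(i, j) (if insub (val i) is Some l then (f l == j)%:R else 0).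
  exists G.
  rewrite -[X in X != _]/(\det _).
  have -> : rowsub (fun i : 'I_k => if insub (val i) is Some j then j else f i) (map_mx (intr : int -> F) G) *m y
     = rowsub f y.
    rewrite [RHS]rowsubE; congr (_ *m y); apply/matrixP => i j; rewrite !mxE.
    have Hi : (i < n)%N by apply: leq_trans (ltn_ord i) kn.
    rewrite (insubT (fun m => (m < n)%N) Hi) /=.
    rewrite (insubT (fun m => (m < k)%N) (ltn_ord i)) /= (_ : Sub _ _ = i); last exact: val_inj.
    by case: eqP.
  by rewrite y1 det1 oner_neq0.
move=> G X.
have XE (f' : 'I_k -> 'I_n) : mxsub f' g X = (rowsub f' (map_mx (intr : int -> K) G) *m Y) *m Z0.
  by rewrite mxsub_mul -/Z {1}ZE mulmxA.
split.
  move=> f'; rewrite XE det_mulmx gramE exprMn mulrC.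
  apply: arch_leM; first by case: cjd.
  apply: arch_le_trans gram_unit; rewrite expr2.
  have H : fin (\det (rowsub f' (map_mx (intr : int -> K) G) *m Y)).
    by apply: fin_det; apply: fin_mulmx => //; exact: fG.
  exact: finM.
move=> nz h; rewrite XE det_mulmx gramE exprMn mulrC [X in arch_le _ X]mulrC mulrC.
apply: arch_leM; first by case: cjd.
apply: (@arch_le_trans _ 1); first exact: fin_det.
rewrite expr2; suff H : arch_le 1 (\det (rowsub (widen_ord h) (map_mx (intr : int -> K) G) *m Y)).
  exact: ge1M.
apply/(st_neq0 stP).
  by apply: fin_det; apply: fin_mulmx => //; exact: fG.
rewrite (st_det stP); last by apply: fin_mulmx => //; exact: fG.
rewrite (st_mulmx stP) //; apply: contraNneq nz => <-; apply/eqP; congr (\det (_ *m _)).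
apply/matrixP => i j; rewrite !mxE (st_int stP).
have Hi : (i < n)%N by apply: leq_trans (ltn_ord i) h.
rewrite (insubT (fun m => (m < n)%N) Hi) /=.
by congr (G _ _)%:~R; apply: val_inj.
Qed.

(** Genericity is a finite conjunction over sizes and column choices, so a single [G] serves them
    all; choices that are not injective receive the constant condition 1. *)
Lemma flag_matrix (A : 'M[K]_n) : A^T = map_mx cj A -> posdef A ->
  exists X : 'M[K]_n,
   (forall k (f g : 'I_k -> 'I_n), injective g ->
      arch_le (\det (mxsub f g X) ^+ 2) (\det (mxsub g g A))) /\
   (forall k (h : (k <= n)%N) (g : 'I_k -> 'I_n), injective g ->
      arch_le (\det (mxsub g g A)) (\det (mxsub (widen_ord h) g X) ^+ 2)).
Proof.
move=> Ah Apos.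
have minor_pos k (g : 'I_k -> 'I_n) : injective g -> 0 < \det (mxsub g g A).
  move=> gi; rewrite -(@pminor_det _ _ A _ g [set g i | i in 'I_k]) //.
    by move=> i; apply: imset_f.
  by rewrite card_imset // card_ord.
have [|U AE] := cholesky cjP rootP Ah.
  by move=> k h; apply: minor_pos => i j /(congr1 val) /= E; apply: val_inj.
pose I := {k : 'I_n.+1 & {ffun 'I_k -> 'I_n}}.
have /choice[P HP] : forall i : I, exists P : 'M[int]_n -> F,
   [/\ poly_on_lines P, exists G, P G != 0 &
    forall G, let X := map_mx (intr : int -> K) G *m U in
      injective (tagged i) ->
      (forall f : 'I_(tag i) -> 'I_n, arch_le (\det (mxsub f (tagged i) X) ^+ 2) (\det (mxsub (tagged i) (tagged i) A))) /\
      (P G != 0 -> forall h : (tag i <= n)%N,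
        arch_le (\det (mxsub (tagged i) (tagged i) A)) (\det (mxsub (widen_ord h) (tagged i) X) ^+ 2))].
  case=> k g /=; case: (pselect (injective g)) => [gi|ngi].
    have [|P [P1 P2 P3]] := @generic_flag_minor U k g.
      by rewrite -AE gt_eqF // minor_pos.
    by exists P; split=> // G _; rewrite AE; exact: (P3 G).
  exists (fun=> 1); split=> [||G /ngi //]; last by exists 0; apply: oner_neq0.
  by move=> a b; exists 1%:P => t; rewrite hornerC.
have [|i|G HG] := @generic_int_matrix F n I P.
- by move=> i; case: (HP i).
- by case: (HP i).
exists (map_mx (intr : int -> K) G *m U).
have main k (g : 'I_k -> 'I_n) : injective g -> (k <= n)%N ->
   (forall f : 'I_k -> 'I_n, arch_le (\det (mxsub f g (map_mx (intr : int -> K) G *m U)) ^+ 2) (\det (mxsub g g A))) /\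
   (forall h : (k <= n)%N,
        arch_le (\det (mxsub g g A)) (\det (mxsub (widen_ord h) g (map_mx (intr : int -> K) G *m U)) ^+ 2)).
  move=> gi kn; pose i : I := @Tagged _ (Ordinal (kn : (k < n.+1)%N)) (fun k : 'I_n.+1 => {ffun 'I_k -> 'I_n}) [ffun j => g j].
  have E m (f : 'I_k -> 'I_m) (M : 'M[K]_(m, n)) : mxsub f (tagged i) M = mxsub f g M.
    by apply/matrixP => a b; rewrite !mxE ffunE.
  have E2 (M : 'M[K]_n) : mxsub (tagged i) (tagged i) M = mxsub g g M.
    by apply/matrixP => a b; rewrite !mxE !ffunE.
  have [_ _ /(_ G) /=] := HP i.
  case; first by move=> a b; rewrite /= !ffunE; apply: gi.
  move=> h1 h2; split=> [f|h].
    by have := h1 f; rewrite E2 E.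
  by have := h2 (HG i) h; rewrite E2 E.
have kle k (g : 'I_k -> 'I_n) : injective g -> (k <= n)%N.
  by move=> gi; have := leq_card g gi; rewrite !card_ord.
split=> [k f g gi|k h g gi]; first by have [] := main k g gi (kle _ _ gi).
by have [_] := main k g gi h; apply.
Qed.

End FlagMatrix.

(** * The exchange inequality for principal minors *)

Section ExchangeMinors.
Variables (K : numFieldType) (n : nat) (A X : 'M[K]_n).
Hypothesis Apos : posdef A.
Hypothesis minor_le : forall k (f g : 'I_k -> 'I_n), injective g ->
  arch_le (\det (mxsub f g X) ^+ 2) (\det (mxsub g g A)).
Hypothesis minor_ge : forall k (h : (k <= n)%N) (g : 'I_k -> 'I_n), injective g ->
  arch_le (\det (mxsub g g A)) (\det (mxsub (widen_ord h) g X) ^+ 2).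

Lemma pminor_le k (f g : 'I_k -> 'I_n) (S : {set 'I_n}) : injective g ->
  (forall i, g i \in S) -> #|S| = k -> arch_le (\det (mxsub f g X) ^+ 2) (pminor A S).
Proof. by move=> gi gS Sk; rewrite (pminor_det A gi gS Sk); apply: minor_le. Qed.

Lemma pminor_ge k (h : (k <= n)%N) (g : 'I_k -> 'I_n) (S : {set 'I_n}) : injective g ->
  (forall i, g i \in S) -> #|S| = k ->
  arch_le (pminor A S) (\det (mxsub (widen_ord h) g X) ^+ 2).
Proof. by move=> gi gS Sk; rewrite (pminor_det A gi gS Sk); apply: minor_ge. Qed.

Lemma flag_minor_neq0 k (h : (k <= n)%N) (g : 'I_k -> 'I_n) : injective g ->
  \det (mxsub (widen_ord h) g X) != 0.
Proof.
move=> gi; apply/eqP => d0; have := minor_ge h gi; rewrite d0 expr0n => /arch_le_eq0/eqP.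
have := Apos [set g i | i in 'I_k].
rewrite (pminor_det A gi) ?card_imset ?card_ord // => [/gt_eqF -> //|i].
exact: imset_f.
Qed.

Lemma det_border k (Ns : 'M[K]_k) (c : 'cV[K]_k) (r : 'rV[K]_k) (x : 'M[K]_1) :
  \det Ns != 0 ->
  \det (block_mx Ns c r x) = \det Ns * (x 0 0 - (r *m invmx Ns *m c) 0 0).
Proof.
move=> d0; have un : Ns \in unitmx by rewrite unitmxE unitfE.
have -> : block_mx Ns c r x =
    block_mx 1%:M 0 (r *m invmx Ns) 1%:M *m block_mx Ns c 0 (x - r *m invmx Ns *m c).
  rewrite mulmx_block !mul1mx !mul0mx !addr0 mulmxKV //.
  by rewrite [_ *m c + _]addrC subrK.
by rewrite det_mulmx det_lblock det_ublock !det1 mulr1 mul1r det_mx11 !mxE.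
Qed.

(* Expanding [det M] along its last row, which is reduced modulo the earlier rows,
   expresses [det Ns * det M] as a sum of products of bordered minors and cofactors. *)
Lemma exchange_minors (S T : {set 'I_n}) : (#|S| < #|T|)%N ->
  exists y, [/\ y \in T, y \notin S &
    arch_le (pminor A S * pminor A T) (pminor A (y |: S) * pminor A (T :\ y))].
Proof.
move=> ltST.
have [t Tt] : exists t, #|T| = t.+1 by case: #|T| ltST => // t _; exists t.
pose gT (i : 'I_t.+1) : 'I_n := enum_val (cast_ord (esym Tt) i).
have gTi : injective gT by move=> i j /enum_val_inj /cast_ord_inj.
have gTT i : gT i \in T by apply: enum_valP.
pose l := #|S|.
pose gS (i : 'I_l) : 'I_n := enum_val i.
have gSi : injective gS by apply: enum_val_inj.
have gSS i : gS i \in S by apply: enum_valP.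
have tn : (t.+1 <= n)%N by rewrite -Tt -[X in (_ <= X)%N](card_ord n) max_card.
have lt : (l < t.+1)%N by rewrite -Tt.
have ln : (l <= n)%N by apply: leq_trans tn; apply: ltnW.
pose M := mxsub (widen_ord tn) gT X; pose Ns := mxsub (widen_ord ln) gS X.
have dM : \det M != 0 by apply: flag_minor_neq0.
have dN : \det Ns != 0 by apply: flag_minor_neq0.
(* [a] is the last row of the flag minor of [T]; [W y] borders the flag minor of [S] by this row and
   the column [y]. *)
pose a := widen_ord tn ord_max.
pose fr (i : 'I_(l + 1)) : 'I_n := match split i with inl i' => widen_ord ln i' | inr _ => a end.
pose gc y (i : 'I_(l + 1)) : 'I_n := match split i with inl i' => gS i' | inr _ => y end.
pose W y := mxsub fr (gc y) X.
pose L := rowsub (fun _ : 'I_1 => a) (colsub gS X) *m invmx Ns.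
have WE y : \det (W y) = \det Ns * (X a y - \sum_i L 0 i * X (widen_ord ln i) y).
  have -> : W y = block_mx Ns (mxsub (widen_ord ln) (fun _ : 'I_1 => y) X)
      (rowsub (fun _ : 'I_1 => a) (colsub gS X)) (const_mx (X a y)).
    apply/matrixP => i j; rewrite !mxE /fr /gc.
    by case: (split i) => i'; rewrite !mxE; case: (split j) => j'; rewrite !mxE.
  rewrite det_border // mxE; congr (_ * (_ - _)).
  by rewrite mxE; apply: eq_bigr => i _; rewrite [X in _ * X]mxE.
have sumE : \det Ns * \det M = \sum_j \det (W (gT j)) * cofactor M ord_max j.
  under eq_bigr do rewrite WE -mulrA mulrBl.
  rewrite -mulr_sumr sumrB; congr (_ * _).
  rewrite (expand_det_row M ord_max) -[LHS]subr0; congr (_ - _).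
    by apply: eq_bigr => j _; rewrite !mxE.
  under eq_bigr do rewrite mulr_suml.
  rewrite exchange_big /= big1 // => i _.
  (* A multiple of an earlier row contributes nothing: against the cofactors of the last row it
     gives an off-diagonal entry of [M * adj M]. The rows of [Ns] lie above the last row of [M]
     because [|S| < |T|]. *)
  pose i' : 'I_t.+1 := widen_ord (ltnW lt) i.
  transitivity (L 0 i * (M *m \adj M) i' ord_max).
    rewrite [X in _ = _ * X]mxE mulr_sumr; apply: eq_bigr => j _; rewrite !mxE -mulrA.
    by congr (_ * (X _ _ * _)); apply: val_inj.
  rewrite mul_mx_adj [X in _ * X]mxE.
  have -> : (i' == ord_max) = false.
    by apply/negP => /eqP/(congr1 val) /= E; have := ltn_ord i; rewrite E ltnNge -ltnS lt.
  by rewrite mulr0.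
have s0 : \sum_j \det (W (gT j)) * cofactor M ord_max j != 0 by rewrite -sumE mulf_neq0.
have [j] := arch_le_sum_exists s0; rewrite -sumE => Hj.
(* Otherwise [W] would have a repeated column and determinant 0. *)
have yS : gT j \notin S.
  apply/negP => yS; have : \det (W (gT j)) != 0.
    apply/negP => /eqP W0; move: Hj; rewrite W0 mul0r => /arch_le_eq0/eqP.
    by rewrite mulf_eq0 (negPf dM) (negPf dN).
  case/negP; apply/eqP.
  pose i0 := enum_rank_in yS (gT j).
  have i0E : gS i0 = gT j by rewrite /gS enum_rankK_in.
  rewrite -det_tr; apply: (@determinant_alternate _ _ _ (lshift 1 i0) (rshift l ord0)).
    by rewrite eq_lrshift.
  move=> i; rewrite !mxE /gc.
  have -> : split (lshift 1 i0) = inl i0 by exact: (unsplitK (inl i0)).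
  have -> : split (rshift l (ord0 : 'I_1)) = inr ord0 by exact: (unsplitK (inr ord0)).
  by rewrite i0E.
exists (gT j); split=> //.
apply: (@arch_le_trans _ ((\det Ns * \det M) ^+ 2)).
  rewrite exprMn; apply: arch_leM; first exact: pminor_ge.
  exact: pminor_ge.
apply: (@arch_le_trans _ ((\det (W (gT j)) * cofactor M ord_max j) ^+ 2)); first exact: arch_leX.
rewrite exprMn; apply: arch_leM.
  apply: pminor_le.
  - move=> i1 i2; rewrite /gc -{2}[i1]splitK -{2}[i2]splitK.
    case: (split i1) => i1'; case: (split i2) => i2' /=.
    + by move/gSi => ->.
    + by move=> E; case/negP: yS; rewrite -E.
    + by move=> E; case/negP: yS; rewrite E.
    + by rewrite !ord1.
  - move=> i; rewrite /gc in_setU1; case: (split i) => i'; first by rewrite gSS orbT.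
    by rewrite eqxx.
  - by rewrite cardsU1 yS addnC.
rewrite /cofactor exprMn sqrr_sign mul1r.
(* The cofactor is a minor on the columns [T :\ y]; the upper bound holds for any choice of rows. *)
have -> : row' ord_max (col' j M) = mxsub (widen_ord tn \o lift ord_max) (gT \o lift j) X.
  by apply/matrixP => i1 i2; rewrite !mxE.
apply: pminor_le.
- by apply: inj_comp => //; apply: lift_inj.
- by move=> i; rewrite !inE gTT andbT (inj_eq gTi) eq_sym neq_lift.
- by apply/eqP; rewrite -eqSS -Tt (cardsD1 (gT j) T) gTT.
Qed.

End ExchangeMinors.

(** * Realization of initial cells *)

Section VectorMatroid.
Variables (F : fieldType) (r m : nat) (M : 'M[F]_(r, m)).

Definition colspan (B : {set 'I_m}) := (\sum_(j in B) <<row j M^T>>)%MS.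

Lemma rank_colsB (B : {set 'I_m}) : \rank (colsB M B) = \rank (colspan B).
Proof.
rewrite -mxrank_tr; apply: eqmx_rank; apply/andP; split.
  apply/row_subP => i.
  have -> : row i (colsB M B)^T = row (enum_val i) M^T by apply/rowP => j; rewrite !mxE.
  by apply: (sumsmx_sup (enum_val i)); rewrite ?enum_valP // genmxE.
apply/sumsmx_subP => j jB; rewrite genmxE.
have -> : row j M^T = row (enum_rank_in jB j) (colsB M B)^T.
  by apply/rowP => i; rewrite !mxE enum_rankK_in.
exact: row_sub.
Qed.

Lemma rank_colsB_det (B : {set 'I_m}) (h : 'I_r -> 'I_m) :
  injective h -> (forall i, h i \in B) -> #|B| = r ->
  \rank (colsB M B) = #|B| <-> \det (colsub h M) != 0.
Proof.
move: M h => N h hi hB Br; subst r.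
have [s Hs] := same_range_perm hi (@enum_val_inj _ (mem B)) hB (@enum_valP _ (mem B)) erefl.
have E : colsB N B = colsub (h \o s) N by apply/matrixP => i j; rewrite !mxE /= -Hs.
have -> : (\det (colsub h N) != 0) = (\det (colsB N B) != 0).
  by rewrite E det_colsub_perm mulf_eq0 signr_eq0.
rewrite -unitfE -unitmxE -row_free_unit /row_free.
by split=> /eqP.
Qed.

(** If no [y] can replace [x], all columns of [B2] lie in the span of [B1 :\ x], whose rank is below
    [r]. *)
Lemma vector_matroid (Bs : {set {set 'I_m}}) : Bs != set0 ->
  (forall B, B \in Bs <-> (#|B| = r /\ \rank (colsB M B) = #|B|)) ->
  is_matroid_bases r Bs.
Proof.
move=> Bs0 HBs; split=> // [B /HBs[] //|B1 B2 B1s B2s x].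
rewrite inE => /andP[xB2 xB1]; apply: contrapT => H.
have [c1 r1] := (HBs B1).1 B1s; have [c2 r2] := (HBs B2).1 B2s.
rewrite !rank_colsB in r1 r2.
set W := colspan (B1 :\ x).
have spU (B : {set 'I_m}) (y : 'I_m) : y \notin B -> colspan (y |: B) = (<<row y M^T>> + colspan B)%MS.
  by move=> yB; rewrite /colspan big_setU1.
have r1x : (r <= \rank (row x M^T) + \rank W)%N.
  have : (\rank (colspan B1) <= \rank (row x M^T) + \rank W)%N; last by rewrite r1 c1.
  rewrite -[in X in (X <= _)%N](setD1K xB1) spU ?setD11 //.
  by apply: leq_trans (mxrank_adds_leqif _ _) _; rewrite genmxE.
have rW : (r <= (\rank W).+1)%N.
  by apply: leq_trans r1x _; rewrite -[X in (_ <= X)%N]add1n leq_add2r rank_leq_row.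
have sub : (colspan B2 <= W)%MS.
  apply/sumsmx_subP => y yB2; rewrite genmxE.
  have [yB1|yB1] := boolP (y \in B1).
    apply: (sumsmx_sup y); rewrite ?genmxE //= !inE yB1 andbT.
    by apply: contraNneq xB2 => <-.
  have yW : y \notin B1 :\ x by rewrite inE negb_and yB1 orbT.
  apply: contrapT => /negP ny; apply: H; exists y; first by rewrite inE yB1.
  have cU : #|B1 :\ x :|: [set y]| = r.
    by rewrite setUC cardsU1 yW -c1 (cardsD1 x B1) xB1.
  apply/HBs; split=> //; rewrite rank_colsB cU setUC spU // -/W.
  apply/eqP; rewrite eqn_leq rank_leq_col /=.
  apply: leq_trans rW _.
  have : (W < <<row y M^T>> + W)%MS.
    by rewrite /ltmx addsmxSr addsmx_sub genmxE negb_and ny.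
  by rewrite ltmxErank => /andP[].
have := mxrankS sub; rewrite r2 c2 leqNgt => /negP; apply.
rewrite -rank_colsB; apply: leq_ltn_trans (rank_leq_col _) _.
by rewrite -c1 [X in (_ < X)%N](cardsD1 x) xB1.
Qed.

End VectorMatroid.

Section DehomogenizedBases.
Variables (n k : nat).

Notation wd := (widen_ord (leqnSn n)).

Definition dehom (B : {set 'I_n.+1}) : {set 'I_n} := [set i | wd i \in B].

(** The last element pads sets of size [k] to size [k + 1]; on the two layers this inverts
    [dehom]. *)
Definition homog (S : {set 'I_n}) : {set 'I_n.+1} :=
  (wd @: S) :|: (if #|S| == k then [set ord_max] else set0).

Lemma wd_inj : injective wd.
Proof. by move=> i j /(congr1 val) /= E; apply: val_inj. Qed.

Lemma wd_neq_max i : (wd i == ord_max) = false.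
Proof. by apply/eqP => /(congr1 val) /= E; have := ltn_ord i; rewrite E ltnn. Qed.

Lemma wd_or_max (j : 'I_n.+1) : j != ord_max -> exists i, j = wd i.
Proof.
move=> jm; have jn : (j < n)%N.
  by rewrite ltn_neqAle -ltnS ltn_ord andbT; apply: contraNneq jm => E; apply/eqP/val_inj.
by exists (Ordinal jn); apply: val_inj.
Qed.

Lemma homogK S : dehom (homog S) = S.
Proof.
apply/setP => i; rewrite !inE mem_imset; last exact: wd_inj.
by case: ifP; rewrite !inE ?wd_neq_max ?orbF.
Qed.

Lemma card_dehom (B : {set 'I_n.+1}) : #|B| = (#|dehom B| + (ord_max \in B))%N.
Proof.
rewrite (cardsD1 ord_max B) addnC; congr (_ + _)%N.
rewrite -(card_imset _ wd_inj); apply: eq_card => j; rewrite !inE.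
apply/andP/imsetP => [[jm jB]|[i iB ->]]; last by rewrite wd_neq_max; move: iB; rewrite inE.
by have [i E] := wd_or_max jm; exists i; rewrite // inE -E.
Qed.

Lemma dehomK (B : {set 'I_n.+1}) : #|B| = k.+1 -> homog (dehom B) = B.
Proof.
move=> Bk; have := card_dehom B; rewrite Bk => Ec.
have Ek : (#|dehom B| == k) = (ord_max \in B).
  move: Ec; case: (ord_max \in B); first by rewrite addn1 => -[<-]; rewrite eqxx.
  by rewrite addn0 => <-; rewrite eqn_leq ltnn.
apply/setP => j; rewrite /homog Ek inE.
have [->|jm] := eqVneq j ord_max.
  case: (boolP (ord_max \in B)) => mB; first by rewrite in_set1 eqxx orbT.
  by rewrite in_set0 orbF; apply/negP => /imsetP[i _ /esym/eqP]; rewrite wd_neq_max.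
have [i ->] := wd_or_max jm; rewrite mem_imset; last exact: wd_inj.
by rewrite inE; case: ifP => _; rewrite ?inE ?wd_neq_max ?orbF.
Qed.

Lemma card_homog S : S \in layers n k -> #|homog S| = k.+1.
Proof.
rewrite inE (card_dehom (homog S)) homogK !inE.
have -> : (ord_max \in wd @: S) = false.
  by apply/negP => /imsetP[i _ /esym/eqP]; rewrite wd_neq_max.
case/orP=> /eqP ->; first by rewrite eqxx in_set1 eqxx addn1.
by rewrite eqn_leq ltnn in_set0 addn0.
Qed.

Lemma dehom_layers (B : {set 'I_n.+1}) : #|B| = k.+1 -> dehom B \in layers n k.
Proof.
rewrite card_dehom inE; case: (ord_max \in B); rewrite ?addn1 ?addn0.
  by case=> ->; rewrite eqxx.
by move=> ->; rewrite eqxx orbT.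
Qed.

Variable RR : realFieldType.

Lemma conv_dehom (D : {set {set 'I_n}}) (x : 'rV[RR]_n) :
  D \subset layers n k ->
  conv D x <-> exists2 y, conv [set B : {set 'I_n.+1} | (#|B| == k.+1) && (dehom B \in D)] y & x = drop_last y.
Proof.
move=> DL; set Bs := [set B | _].
have re (V : nmodType) (f : {set 'I_n} -> V) : \sum_(S in D) f S = \sum_(B in Bs) f (dehom B).
  rewrite (reindex_onto dehom homog) => [|S _]; last exact: homogK.
  apply: eq_bigl => B; rewrite inE andbC; case: (boolP (dehom B \in D)) => BD; rewrite ?andbF ?andbT //.
  apply/eqP/eqP => [<-|]; last exact: dehomK.
  by apply: card_homog; apply: (subsetP DL).
have dropE (m : {set 'I_n.+1} -> RR) :
   drop_last (\sum_(B in Bs) m B *: ind RR B) = \sum_(B in Bs) m B *: ind RR (dehom B).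
  apply/rowP => i; rewrite mxE !summxE; apply: eq_bigr => B _.
  by rewrite !mxE inE.
split.
  move=> [l [l0 l1 ->]]; exists (\sum_(B in Bs) l (dehom B) *: ind RR B).
    by exists (fun B => l (dehom B)); split=> //; rewrite -re.
  by rewrite dropE re.
case=> _ [m [m0 m1 ->]] ->; rewrite dropE; exists (fun S => m (homog S)); split=> //.
  by rewrite re -m1; apply: eq_bigr => B; rewrite inE => /andP[/eqP Bk _]; rewrite dehomK.
by rewrite re; apply: eq_bigr => B; rewrite inE => /andP[/eqP Bk _]; rewrite dehomK.
Qed.

End DehomogenizedBases.

Section Realization.
Variables (K F : numFieldType) (n : nat) (A X : 'M[K]_n).
Hypothesis Apos : posdef A.
Hypothesis minor_le : forall k (f g : 'I_k -> 'I_n), injective g ->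
  arch_le (\det (mxsub f g X) ^+ 2) (\det (mxsub g g A)).
Hypothesis minor_ge : forall k (h : (k <= n)%N) (g : 'I_k -> 'I_n), injective g ->
  arch_le (\det (mxsub g g A)) (\det (mxsub (widen_ord h) g X) ^+ 2).
Variable st : K -> F.
Hypothesis stP : standard_part st.

Lemma arch_le_sqr (x y : K) : arch_le (x ^+ 2) (y ^+ 2) -> arch_le x y.
Proof.
case=> N; rewrite !normrX => HN; exists N.+1.
rewrite -(@ler_pXn2r _ 2) ?nnegrE ?mulr_ge0 ?ler0n //.
apply: le_trans HN _; rewrite exprMn ler_wpM2r ?exprn_ge0 //.
by rewrite -natrX ler_nat expnS (leq_trans (leqnSn N)) // leq_pmulr.
Qed.

(** The multiplicative form of [weight]. *)
Definition scaled (d : 'I_n -> K) (S : {set 'I_n}) : K := pminor A S * \prod_(i in S) d i.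

Variables (k : nat) (kn : (k < n)%N) (d e : 'I_n -> K).
Hypothesis e_sqr : forall i, e i ^+ 2 = d i.
Hypothesis d_pos : forall i, 0 < d i.

Notation wd := (widen_ord (leqnSn n)).

(** The last column is the last unit vector, so a minor through it reduces to a flag minor of size
    [k]. Columns are scaled by square roots because [scaled] is compared with squared minors. *)
Definition dehom_mx : 'M[K]_(k.+1, n.+1) := \matrix_(i, j)
  (if unlift ord_max j is Some j' then X (widen_ord kn i) j' * e j' else (i == ord_max)%:R).

Lemma dehom_mx_wd i j : dehom_mx i (wd j) = X (widen_ord kn i) j * e j.
Proof.
have -> : wd j = lift ord_max j by apply: val_inj; rewrite /= /bump leqNgt ltn_ord.
by rewrite mxE liftK.
Qed.

Lemma dehom_mx_max i : dehom_mx i ord_max = (i == ord_max)%:R.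
Proof. by rewrite mxE unlift_none. Qed.

Lemma prod_sqr m (g : 'I_m -> 'I_n) (S : {set 'I_n}) : injective g ->
  (forall i, g i \in S) -> #|S| = m -> (\prod_i e (g i)) ^+ 2 = \prod_(i in S) d i.
Proof.
move=> gi gS Sm; have -> : S = [set g i | i in 'I_m].
  apply/esym/eqP; rewrite eqEcard card_imset // card_ord Sm leqnn andbT.
  by apply/subsetP => _ /imsetP[i _ ->].
rewrite big_imset /=; last by move=> i j _ _; apply: gi.
by rewrite -prodrXl; apply: eq_bigr => i _; rewrite e_sqr.
Qed.

Lemma scaled_minor m (h : (m <= n)%N) (g : 'I_m -> 'I_n) (S : {set 'I_n}) : injective g ->
  (forall i, g i \in S) -> #|S| = m ->
  let x := \det (\matrix_(i, j) (X (widen_ord h i) (g j) * e (g j))) in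
  arch_le (x ^+ 2) (scaled d S) /\ arch_le (scaled d S) (x ^+ 2).
Proof.
move=> gi gS Sm x.
have -> : x = \det (mxsub (widen_ord h) g X) * \prod_i e (g i).
  rewrite -[\prod_i _](_ : \det (diag_mx (\row_i e (g i))) = _).
    rewrite -det_mulmx; congr (\det _); apply/matrixP => i j.
    by rewrite mul_mx_diag !mxE.
  by rewrite det_diag; apply: eq_bigr => i _; rewrite mxE.
rewrite exprMn (prod_sqr gi gS Sm) /scaled (pminor_det A gi gS Sm).
split; apply: arch_leM; try exact: arch_le_refl; [exact: minor_le|exact: minor_ge].
Qed.

Lemma dehom_minor (h : 'I_k.+1 -> 'I_n.+1) (B : {set 'I_n.+1}) : injective h ->
  (forall i, h i \in B) -> #|B| = k.+1 ->
  let x := \det (colsub h dehom_mx) in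
  arch_le (x ^+ 2) (scaled d (dehom B)) /\ arch_le (scaled d (dehom B)) (x ^+ 2).
Proof.
move=> hi hB Bk x; have := card_dehom B; rewrite Bk.
have imB : h @: [set: 'I_k.+1] = B.
  apply/eqP; rewrite eqEcard card_imset // cardsT card_ord Bk leqnn andbT.
  by apply/subsetP => _ /imsetP[i _ ->].
case: (boolP (ord_max \in B)) => mB; rewrite ?addn1 ?addn0 => cB.
  have /imsetP[j0 _ hj0] : ord_max \in h @: [set: 'I_k.+1] by rewrite imB.
  have /choice[g Hg] : forall i, exists j, h (lift j0 i) = wd j.
    move=> i; apply: wd_or_max; rewrite hj0 (inj_eq hi) eq_sym.
    exact: neq_lift.
  have gi : injective g.
    by move=> i j E; apply: (@lift_inj _ j0); apply: hi; rewrite !Hg E.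
  have gS i : g i \in dehom B by rewrite inE -Hg.
  have ck : #|dehom B| = k by case: cB.
  have -> : x ^+ 2 = \det (\matrix_(i < k, j < k) (X (widen_ord (ltnW kn) i) (g j) * e (g j))) ^+ 2.
    rewrite /x (expand_det_col _ j0) (bigD1 ord_max) //= big1 ?addr0 => [|i im].
      rewrite !mxE -hj0 unlift_none eqxx mul1r /cofactor exprMn sqrr_sign mul1r.
      congr (\det _ ^+ 2); apply/matrixP => i j; rewrite [LHS]mxE [LHS]mxE [LHS]mxE Hg dehom_mx_wd mxE.
      by congr (X _ _ * _); apply: val_inj; rewrite /= /bump leqNgt ltn_ord.
    by rewrite mxE -hj0 dehom_mx_max (negPf im) mul0r.
  exact: scaled_minor.
have /choice[g Hg] : forall i, exists j, h i = wd j.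
  by move=> i; apply: wd_or_max; apply: contraNneq mB => <-.
have gi : injective g by move=> i j E; apply: hi; rewrite !Hg E.
have gS i : g i \in dehom B by rewrite inE -Hg.
have -> : x = \det (\matrix_(i, j) (X (widen_ord kn i) (g j) * e (g j))).
  by congr (\det _); apply/matrixP => i j; rewrite mxE Hg dehom_mx_wd mxE.
exact: scaled_minor.
Qed.

Lemma scaled_pos S : 0 < scaled d S.
Proof. by rewrite mulr_gt0 ?Apos // prodr_gt0. Qed.

(** The bases are the sets whose minor of [dehom_mx] has the largest archimedean class. Dividing by
    the block of [B0] makes the matrix finite, and the standard part keeps exactly these minors
    nonzero. *)
Lemma initial_cell_realizable (RR : realFieldType) (D : {set {set 'I_n}}) (B0 : {set 'I_n}) :
  D \subset layers n k -> B0 \in D ->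
  (forall S, S \in layers n k -> arch_le (scaled d S) (scaled d B0) /\
      (S \in D <-> arch_le (scaled d B0) (scaled d S))) ->
  realizable_dehom_matroid_polytope F (@conv RR n D).
Proof.
move=> DL B0D HD.
exists k, [set B : {set 'I_n.+1} | (#|B| == k.+1) && (dehom B \in D)].
have enumB (B : {set 'I_n.+1}) : #|B| = k.+1 ->
    exists h : 'I_k.+1 -> 'I_n.+1, injective h /\ (forall i, h i \in B).
  move=> Bk; exists (fun i => enum_val (cast_ord (esym Bk) i)); split.
    by move=> i j /enum_val_inj /cast_ord_inj.
  by move=> i; apply: enum_valP.
have B0L := subsetP DL _ B0D.
have cB0 := card_homog B0L.
have [h0 [h0i h0B]] := enumB _ cB0.
have [min0 max0] := dehom_minor h0i h0B cB0; rewrite homogK in min0 max0.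
have minorT (h : 'I_k.+1 -> 'I_n.+1) : \det (rowsub h dehom_mx^T) = \det (colsub h dehom_mx).
  by rewrite -det_tr; congr (\det _); apply/matrixP => i j; rewrite !mxE.
have d0 : \det (rowsub h0 dehom_mx^T) != 0.
  rewrite minorT; apply/eqP => E; move: max0; rewrite E expr0n => /arch_le_eq0 /eqP.
  by rewrite gt_eqF // scaled_pos.
have [|ZE Y1 Yfin] := maximal_minor_basis d0.
  move=> h; case: (pselect (injective h)) => [hi|nhi]; last first.
    by rewrite det_rowsub_noninj //; apply: arch_le0.
  rewrite !minorT; apply: arch_le_sqr; pose B := [set h i | i in 'I_k.+1].
  have Bk : #|B| = k.+1 by rewrite card_imset // card_ord.
  have hB i : h i \in B by apply: imset_f.
  have [m1 _] := dehom_minor hi hB Bk.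
  apply: arch_le_trans m1 _; apply: arch_le_trans max0.
  by case: (HD _ (dehom_layers Bk)).
set Y := _ *m invmx _ in ZE Y1 Yfin.
have key (B : {set 'I_n.+1}) : #|B| = k.+1 ->
    \rank (colsB (map_mx st Y)^T B) = #|B| <-> dehom B \in D.
  move=> Bk; have [h [hi hB]] := enumB _ Bk.
  have [m1 m2] := dehom_minor hi hB Bk.
  rewrite (rank_colsB_det _ hi hB Bk) (HD _ (dehom_layers Bk)).2.
  have -> : \det (colsub h (map_mx st Y)^T) = st (\det (rowsub h Y)).
    rewrite (st_det stP) => [|i j]; last by rewrite mxE.
    by rewrite -det_tr; congr (\det _); apply/matrixP => i j; rewrite !mxE.
  have fd : fin (\det (rowsub h Y)) by apply: fin_det => i j; rewrite mxE.
  have dE : \det (colsub h dehom_mx) = \det (rowsub h Y) * \det (colsub h0 dehom_mx).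
    by rewrite -!minorT -det_mulmx mul_rowsub_mx -ZE.
  rewrite (st_neq0 stP fd); split=> [H|H].
    apply: arch_le_trans max0 (arch_le_trans _ m1); apply: arch_leX.
    by rewrite dE -[X in arch_le X _]mul1r; apply: arch_leM => //; apply: arch_le_refl.
  apply: (arch_le_pM2r d0); rewrite mul1r minorT -dE; apply: arch_le_sqr.
  exact: arch_le_trans min0 (arch_le_trans H m2).
have real (B : {set 'I_n.+1}) : B \in [set B : {set 'I_n.+1} | (#|B| == k.+1) && (dehom B \in D)] <->
    (#|B| = k.+1 /\ \rank (colsB (map_mx st Y)^T B) = #|B|).
  rewrite inE; split=> [/andP[/eqP Bk BD]|[Bk rk]]; first by split=> //; apply/key.
  by rewrite Bk eqxx; apply/key.
split=> //.
- by apply: (@vector_matroid F k.+1 n.+1 (map_mx st Y)^T) real; apply/set0Pn; exists (homog k B0);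
   rewrite inE cB0 eqxx homogK.
- by exists (map_mx st Y)^T.
- by move=> x; apply: conv_dehom.
Qed.

End Realization.

(** * Positive definite matrices over a field with a place *)

(* An additive copy of the multiplicative group of positive elements, so that
   Motzkin's theorem applies to it with integer coefficients. *)
Definition posK (K : numFieldType) := {x : K | 0 < x}.
HB.instance Definition _ (K : numFieldType) := Choice.copy (posK K) {x : K | 0 < x}.

Section PositiveElements.
Variable K : numFieldType.

Definition posK_zero : posK K := exist _ 1 ltr01.
Definition posK_opp (u : posK K) : posK K :=
  exist _ (sval u)^-1 (etrans (invr_gt0 (sval u)) (svalP u)).
Definition posK_add (u v : posK K) : posK K :=
  exist _ (sval u * sval v) (mulr_gt0 (svalP u) (svalP v)).

Lemma posK_addA : associative posK_add.
Proof. by move=> u v w; apply: val_inj; rewrite /= mulrA. Qed.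
Lemma posK_addC : commutative posK_add.
Proof. by move=> u v; apply: val_inj; rewrite /= mulrC. Qed.
Lemma posK_add0 : left_id posK_zero posK_add.
Proof. by move=> u; apply: val_inj; rewrite /= mul1r. Qed.
Lemma posK_addN : left_inverse posK_zero posK_opp posK_add.
Proof. by move=> u; apply: val_inj; rewrite /= mulVf // gt_eqF // (svalP u). Qed.

HB.instance Definition _ :=
  GRing.isZmodule.Build (posK K) posK_addA posK_addC posK_add0 posK_addN.

Lemma sval_sum (I : finType) (P : pred I) (f : I -> posK K) :
  sval (\sum_(i | P i) f i) = \prod_(i | P i) sval (f i).
Proof. by elim/big_rec2: _ => // i x y _ <-. Qed.

Lemma sval_mulrn (u : posK K) m : sval (u *+ m) = sval u ^+ m.
Proof.
elim: m => [|m IH]; first by rewrite mulr0n expr0.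
by rewrite mulrS exprS -IH.
Qed.

Definition nnK (u : zmodule (posK K)) : Prop := arch_le 1 (sval (u : posK K)).

Lemma nnK_sub (u v : posK K) : nnK (u - v) <-> arch_le (sval v) (sval u).
Proof.
have v0 : sval v != 0 by rewrite gt_eqF // (svalP v).
have -> : nnK (u - v) = arch_le 1 (sval u / sval v) by [].
split=> H.
  by apply: (arch_le_pM2r (t := (sval v)^-1)); rewrite ?invr_neq0 // mulfV.
by rewrite -(mulfV v0); apply: arch_leM => //; apply: arch_le_refl.
Qed.

Hypothesis rootP : forall x : K, 0 < x -> forall m, (0 < m)%N -> exists2 y, 0 < y & y ^+ m = x.
Hypothesis nonarchimedean : exists2 x : K, 0 < x & ~ arch_le x 1.

(** Integer scalars act as powers: roots give divisibility, and an element that is not finite keeps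
    the preorder from being trivial. *)
Lemma preordered_posK : @preordered int (zmodule (posK K)) nnK.
Proof.
have pow1 x m : arch_le (1 : K) x -> arch_le 1 (x ^+ m).
  by move=> H; elim: m => [|m IH]; [exact: arch_le_refl | rewrite exprS; apply: ge1M].
have scE (m : nat) (v : zmodule (posK K)) : sval (m%:Z *: v : posK K) = sval (v : posK K) ^+ m.
  by rewrite scalezrE -pmulrn sval_mulrn.
split.
- move=> v; have := arch_le_total 1 (sval (v : posK K)) => -[H|H]; [by left|right].
  by rewrite -[- v]add0r; apply/nnK_sub.
- by move=> u v; apply: ge1M.
- by case=> // m v _ H; rewrite /nnK scE; apply: pow1.
- case=> // -[//|m] v _; rewrite /nnK scE => H.
  case: (arch_le_total 1 (sval (v : posK K))) => // H1.
  apply: arch_le_trans H _; rewrite exprS -[X in arch_le _ X]mulr1; apply: arch_leM; first exact: arch_le_refl.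
  by elim: m => [|m IH]; [exact: arch_le_refl | rewrite exprS; apply: finM].
- case=> // -[//|m] v _; have [y y0 yE] := rootP (svalP (v : posK K)) (ltn0Sn m).
  by exists (exist _ y y0 : posK K); apply: val_inj; rewrite [LHS]scE.
- have [x x0 nx] := nonarchimedean; exists (exist _ x x0 : posK K) => H.
  by apply: nx; apply/(nnK_sub 0 (exist _ x x0 : posK K)); rewrite sub0r.
Qed.

End PositiveElements.

Section Core.
Variables (K F : numFieldType) (cj : {rmorphism K -> K}) (cjF : {rmorphism F -> F}).
Hypothesis cjP : forall x, x * cj x = `|x| ^+ 2.
Hypothesis cjFP : forall x, x * cjF x = `|x| ^+ 2.
Hypothesis rootP : forall x : K, 0 < x -> forall m, (0 < m)%N -> exists2 y, 0 < y & y ^+ m = x.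
Hypothesis nonarchimedean : exists2 x : K, 0 < x & ~ arch_le x 1.
Variable st : K -> F.
Hypothesis stP : standard_part st.
Hypothesis st_cj : forall x, fin x -> st (cj x) = cjF (st x).
Variables (RR : realType) (v : K -> RR).
Hypothesis vM : forall x y, 0 < x -> 0 < y -> v (x * y) = v x + v y.
Hypothesis v_le : forall x y, 0 < x -> 0 < y -> arch_le x y -> v x <= v y.

Lemma posdef_minors_coarsen n (A : 'M[K]_n) : (0 < n)%N -> A^T = map_mx cj A -> posdef A ->
  coarsens_realizable_matroid_subdivision F (fun S => v (pminor A S)).
Proof.
move=> n0 Ah Apos.
have [X [Xle Xge]] := flag_matrix cjP cjFP rootP stP st_cj Ah Apos.
pose V : lmodType int := zmodule (posK K).
pose vf (u : V) : RR := v (sval (u : posK K)).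
have v1 : v 1 = 0.
  by have := vM ltr01 ltr01; rewrite mulr1 -{1}[v 1]addr0 => /addrI.
have vfB : zmod_morphism vf.
  move=> x y; rewrite /vf.
  have -> : sval (x - y : posK K) = sval (x : posK K) / sval (y : posK K) by [].
  have y0 := svalP (y : posK K).
  rewrite vM ?invr_gt0 ?(svalP (x : posK K)) //; congr (_ + _).
  have iy0 : 0 < (sval (y : posK K))^-1 by rewrite invr_gt0.
  have := vM y0 iy0; rewrite mulfV ?gt_eqF // v1 => /esym/eqP.
  by rewrite addrC addr_eq0 => /eqP.
pose vv : {additive V -> RR} := HB.pack vf (GRing.isZmodMorphism.Build V RR vf vfB).
pose a (S : {set 'I_n}) : V := (exist _ (pminor A S) (Apos S) : posK K).
have vv0 u : nnK u -> 0 <= vv u.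
  by move=> H; rewrite -v1; exact: (v_le ltr01 (svalP (u : posK K)) H).
have exch (S T : {set 'I_n}) : (#|S| < #|T|)%N ->
    exists y, [/\ y \in T, y \notin S & nnK (a (y |: S) + a (T :\ y) - a S - a T)].
  move=> ST; have [y [yT yS H]] := exchange_minors Apos Xle Xge ST.
  by exists y; split=> //; rewrite -addrA -opprD; apply/nnK_sub.
have [Sig [Sig1 Sig2 Sig3]] := initial_subdivision (preordered_posK rootP nonarchimedean) vv0 exch n0.
exists Sig; split=> // D /Sig2[k kn [DL [d [B0 [B0D HD]]]]].
pose dK i := sval (d i : posK K).
(* Square roots of the weights become the column scalings of the realizing matrix. *)
have /choice[e He] : forall i, exists y, y ^+ 2 = dK i.
  by move=> i; have [y _ yE] := rootP (svalP (d i : posK K)) (ltn0Sn 1); exists y.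
have wE S : sval (weight a d S : posK K) = scaled A dK S.
  by rewrite /weight /scaled -(sval_sum (mem S) (d : 'I_n -> posK K)).
have dpos i : 0 < dK i by exact: (svalP (d i : posK K)).
apply: (initial_cell_realizable Apos Xle Xge stP kn He dpos RR DL B0D) => S SL.
have [h1 h2] := HD S SL; rewrite -!wE; split; first exact/nnK_sub.
by rewrite h2; apply: nnK_sub.
Qed.

End Core.

(** * Standard parts over real closed fields and their complexifications *)

Lemma ler_dist_mul (T : realFieldType) (x y p q e N M : T) : 0 <= e <= 1 ->
  `|x| <= N -> `|y| <= M -> `|x - p| <= e -> `|y - q| <= e ->
  `|x * y - p * q| <= (N + M + 1) * e.
Proof.
move=> /andP[e0 e1] hx hy hp hq.
have -> : x * y - p * q = x * (y - q) + (x - p) * y - (x - p) * (y - q) by ring.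
apply: le_trans (ler_normB _ _) _.
apply: le_trans (lerD (ler_normD _ _) (lexx _)) _; rewrite !normrM.
have h1 : `|x| * `|y - q| <= N * e by apply: ler_pM.
have h2 : `|x - p| * `|y| <= e * M by apply: ler_pM.
have h3 : `|x - p| * `|y - q| <= 1 * e by apply: ler_pM => //; apply: le_trans hp e1.
lra.
Qed.

Section RealStandardPart.
Variables (R : rcfType) (RR : realType).

(** [R] and [RR] are compared only through the rationals: the lower rational cut of [x] is read in
    [RR]. *)
Definition rat_cut (x : R) : classical_sets.set RR :=
  fun y => exists2 p : rat, ratr p <= x & y = ratr p.

Definition std (x : R) : RR := sup (rat_cut x).

Lemma fin_bound (x : R) : fin x -> exists2 N : nat, - ratr N%:R <= x & x <= ratr N%:R.
Proof.
case=> N; rewrite normr1 mulr1 ler_norml => /andP[h1 h2].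
by exists N; rewrite ratr_nat.
Qed.

Lemma std_ge (x : R) (p : rat) : fin x -> ratr p <= x -> ratr p <= std x.
Proof.
case/fin_bound=> N _ xN px; apply: sup_upper_bound; last by exists p.
split; first by exists (ratr p); exists p.
exists (ratr N%:R) => _ [q qx ->]; rewrite ler_rat.
by have := le_trans qx xN; rewrite ler_rat.
Qed.

Lemma std_le (x : R) (p : rat) : fin x -> x <= ratr p -> std x <= ratr p.
Proof.
case/fin_bound=> N Nx _ xp; apply: ge_sup.
  by exists (ratr (- N%:R)); exists (- N%:R) => //; rewrite rmorphN.
by move=> _ [q qx ->]; rewrite ler_rat; have := le_trans qx xp; rewrite ler_rat.
Qed.

Lemma std_close (x : R) (p e : rat) : fin x ->
  `|x - ratr p| <= ratr e -> `|std x - ratr p| <= ratr e.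
Proof.
move=> fx; rewrite !ler_distl -!rmorphB -!rmorphD /= => /andP[h1 h2].
by rewrite std_ge // std_le.
Qed.

Lemma rat_approx (x : R) (e : rat) : fin x -> 0 < e -> exists p : rat, `|x - ratr p| <= ratr e.
Proof.
move=> fx e0.
have e2 : 0 < e / 2%:R by rewrite divr_gt0 // ltr0n.
have re2 : 0 < ratr (e / 2%:R) :> RR by rewrite ltr0q.
have [|p] := @rat_in_itvoo RR (std x - ratr (e / 2%:R)) (std x).
  by rewrite gtrBl.
rewrite in_itv /= => /andP[h1 h2]; exists p.
have eE : e = e / 2%:R + e / 2%:R by lra.
rewrite ler_distl -rmorphB -rmorphD /=; apply/andP; split.
  have [//|H] := leP (ratr (p - e)) x.
  have := std_le fx (ltW H); rewrite {1}eE !rmorphB rmorphD /=; lra.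
have [//|H] := leP x (ratr (p + e)).
have := std_ge fx (ltW H); rewrite {1}eE !rmorphD /=; lra.
Qed.

Lemma eq_rat_close (a b C : RR) : (forall e : rat, 0 < e -> e <= 1 -> `|a - b| <= C * ratr e) -> a = b.
Proof.
move=> H; apply/eqP; rewrite -subr_eq0 -normr_le0 leNgt; apply/negP => d0.
set d := `|a - b| in H d0.
have C0 : 0 < C.
  by have := H 1 ltr01 (lexx _); rewrite rmorph1 mulr1; apply: lt_le_trans.
have [|e] := @rat_in_itvoo RR 0 (Num.min 1 (d / (C + 1))).
  by rewrite lt_min ltr01 divr_gt0 // addr_gt0.
rewrite in_itv /= lt_min => /andP[e0 /andP[e1 ed]].
have := H e; rewrite -(ltr0q RR) e0 -(ler_rat RR) rmorph1 (ltW e1) => /(_ isT isT).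
move: ed; rewrite ltr_pdivlMr ?addr_gt0 //; nra.
Qed.

(** A rational approximation of a finite [x] within [e] also approximates [std x] within [e], so
    sums and products are preserved up to a fixed multiple of every rational [e]. *)
Lemma standard_part_real : standard_part std.
Proof.
have std_rat p : std (ratr p) = ratr p.
  have f : fin (ratr p : R).
    exists (Num.bound `|p|); rewrite normr1 mulr1 -ratr_nat -ratr_norm ler_rat.
    exact/ltW/archi_boundP.
  by apply/le_anti; rewrite std_le //= std_ge.
split.
- by have := std_rat 1; rewrite !rmorph1.
(* The error is [2 e] for the sum and [e] for each summand. *)
- move=> x y fx fy; apply: (@eq_rat_close _ _ 4%:R) => e e0 _.
  have [p Hp] := rat_approx fx e0; have [q Hq] := rat_approx fy e0.
  have Hpq : `|std (x + y) - ratr (p + q)| <= ratr (e + e).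
    apply: std_close; first exact: arch_leD.
    rewrite !rmorphD /= opprD addrACA.
    by apply: le_trans (ler_normD _ _) _; apply: lerD.
  have := std_close fx Hp; have := std_close fy Hq; move: Hpq.
  rewrite !ler_norml !rmorphD /= => /andP[? ?] /andP[? ?] /andP[? ?]; apply/andP; split; lra.
- move=> x y fx fy.
  have [N Nx xN] := fin_bound fx; have [M My yM] := fin_bound fy.
  rewrite !ratr_nat in Nx xN My yM.
  (* Both [std (x * y)] and [std x * std y] are within [(N + M + 1) e] of [p q]. *)
  apply: (@eq_rat_close _ _ (2%:R * (N%:R + M%:R + 1))) => e e0 e1.
  have re0 : 0 < ratr e :> R by rewrite ltr0q.
  have re1 : ratr e <= 1 :> R by rewrite -(rmorph1 (ratr : rat -> R)) ler_rat.
  have se0 : 0 < ratr e :> RR by rewrite ltr0q.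
  have se1 : ratr e <= 1 :> RR by rewrite -(rmorph1 (ratr : rat -> RR)) ler_rat.
  have [p Hp] := rat_approx fx e0; have [q Hq] := rat_approx fy e0.
  have H1 : `|std (x * y) - ratr (p * q)| <= ratr ((N%:R + M%:R + 1) * e).
    apply: std_close; first exact: finM.
    rewrite !rmorphM !rmorphD /= !ratr_nat rmorph1; apply: ler_dist_mul => //.
    - by rewrite ltW.
    - by rewrite ler_norml Nx.
    - by rewrite ler_norml My.
  have H2 : `|std x * std y - ratr (p * q)| <= ratr ((N%:R + M%:R + 1) * e).
    rewrite !rmorphM !rmorphD /= !ratr_nat rmorph1; apply: ler_dist_mul => //.
    - by rewrite ltW.
    - have := @std_close x 0 N%:R fx; rewrite !rmorph0 !subr0 !ratr_nat; apply.
      by rewrite ler_norml Nx.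
    - have := @std_close y 0 M%:R fy; rewrite !rmorph0 !subr0 !ratr_nat; apply.
      by rewrite ler_norml My.
    - exact: std_close.
    - exact: std_close.
  move: H1 H2; rewrite !rmorphM !rmorphD /= !ratr_nat rmorph1.
  rewrite !ler_norml => /andP[? ?] /andP[? ?]; apply/andP; split; lra.
- move=> x fx; split=> [|[N]].
    move=> s0; apply: contrapT => nx.
    have small m : `|x| * m%:R <= 1.
      rewrite leNgt; apply/negP => H; apply: nx; exists m; rewrite normr1 mulrC.
      exact: ltW.
    have : std x = 0.
      apply: (@eq_rat_close _ _ 1) => e e0 _; rewrite mul1r.
      have := @std_close x 0 e fx; rewrite !rmorph0 !subr0; apply.
      have [m Hm] : exists m : nat, 1 <= e * m%:R.
        exists (Num.bound e^-1); have := archi_boundP (ltW (etrans (invr_gt0 e) e0)).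
        by move=> /ltW; rewrite -ler_pdivrMl // mulr1.
      have m0 : 0 < m%:R :> R.
        rewrite ltr0n lt0n; apply/negP => /eqP m0.
        by move: Hm; rewrite m0 mulr0 ler10.
      rewrite -(ler_pM2r m0); apply: le_trans (small m) _.
      by rewrite -(ratr_nat R m) -rmorphM /= -(rmorph1 (ratr : rat -> R)) ler_rat.
    by move/eqP; rewrite (negPf s0).
  rewrite normr1 => H.
  have N0 : 0 < N%:R :> rat.
    rewrite ltr0n lt0n; apply/negP => /eqP N0; move: H; rewrite N0 mul0r.
    by rewrite ler10.
  have i0 : 0 < ratr (N%:R^-1) :> RR by rewrite ltr0q invr_gt0.
  have N0R : 0 < N%:R :> R by rewrite -(ratr_nat R) ltr0q.
  have Hx : ratr N%:R^-1 <= `|x|.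
    by rewrite fmorphV /= ratr_nat -(ler_pM2l N0R) mulfV // gt_eqF.
  move: Hx; rewrite ler_normr => /orP[/(std_ge fx) h|h].
    by rewrite gt_eqF // (lt_le_trans i0 h).
  rewrite lt_eqF //; apply: le_lt_trans (_ : ratr (- N%:R^-1) < 0); last first.
    by rewrite rmorphN oppr_lt0.
  by apply: std_le => //; rewrite rmorphN /= lerNr.
Qed.

End RealStandardPart.

Section ComplexStandardPart.
Variable R : rcfType.
Local Open Scope complex_scope.
Notation Re := (@complex.Re R).
Notation Im := (@complex.Im R).

Lemma norm_Re_Im (z : R[i]) : exists r : R, [/\ `|z| = r%:C,
  `|Re z| <= r, `|Im z| <= r & r <= `|Re z| + `|Im z|].
Proof.
exists (Num.sqrt (Re z ^+ 2 + Im z ^+ 2)); rewrite normc_def; split=> //.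
- by rewrite -sqrtr_sqr; apply: ler_wsqrtr; rewrite lerDl sqr_ge0.
- by rewrite -sqrtr_sqr; apply: ler_wsqrtr; rewrite lerDr sqr_ge0.
- apply: (@le_trans _ _ (Num.sqrt ((`|Re z| + `|Im z|) ^+ 2))); last first.
    by rewrite sqrtr_sqr ger0_norm // addr_ge0.
  apply: ler_wsqrtr; rewrite sqrrD !real_normK ?num_real // addrAC lerDl.
  by rewrite mulrn_wge0 // mulr_ge0.
Qed.

Lemma natC (N : nat) : N%:R = (N%:R : R)%:C :> R[i].
Proof. by rewrite rmorph_nat. Qed.

Lemma arch_le_real (x y : R) : arch_le x%:C y%:C <-> arch_le x y.
Proof.
have nE (a : R) : `|a%:C| = `|a|%:C by rewrite normc_def /= expr0n addr0 sqrtr_sqr.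
by split=> -[N HN]; exists N; move: HN; rewrite !nE natC -rmorphM lecR.
Qed.

Lemma fin_Re_Im (z : R[i]) : fin z -> fin (Re z) /\ fin (Im z).
Proof.
have [r [zr r1 r2 _]] := norm_Re_Im z.
case=> N; rewrite zr normr1 mulr1 natC lecR => rN.
by split; exists N; rewrite normr1 mulr1; [apply: le_trans r1 rN|apply: le_trans r2 rN].
Qed.

Lemma ge1_Re_Im (z : R[i]) : arch_le 1 z <-> arch_le 1 (Re z) \/ arch_le 1 (Im z).
Proof.
have [r [zr r1 r2 r3]] := norm_Re_Im z; split.
  case=> N; rewrite zr normr1 natC -rmorphM -(rmorph1 (real_complex R)) lecR => H.
  have H' : 1 <= N%:R * (`|Re z| + `|Im z|).
    by apply: le_trans H _; rewrite ler_wpM2l ?ler0n.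
  have [h|h] := lerP (`|Im z|) (`|Re z|); [left|right]; exists (N + N)%N;
    rewrite normr1 natrD mulrDl -mulrDr; apply: le_trans H' _;
    by rewrite ler_wpM2l ?ler0n //; lra.
by case=> -[N]; rewrite normr1 => H; exists N; rewrite zr normr1 natC -rmorphM
  -(rmorph1 (real_complex R)) lecR; apply: le_trans H _; rewrite ler_wpM2l ?ler0n.
Qed.

Lemma gt0_real_complex (z : R[i]) : 0 < z -> z = (Re z)%:C /\ 0 < Re z.
Proof.
by rewrite ltcE /= => /andP[/eqP I0 r0]; split=> //; case: z I0 {r0} => a b /= ->.
Qed.

(** Intermediate values of [X^m - x] on [[0, x + 1]], using [(x + 1)^m >= x + 1]. *)
Lemma pos_root (x : R) : 0 < x -> forall m, (0 < m)%N -> exists2 y, 0 < y & y ^+ m = x.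
Proof.
move=> x0 m m0.
have [||y /andP[y0 _]] := @poly_ivt R ('X^m - x%:P) 0 (x + 1).
- by rewrite addr_ge0 // ltW.
- rewrite !hornerE expr0n gtn_eqF //= sub0r oppr_le0 (ltW x0) /= subr_ge0.
  apply: le_trans (_ : x + 1 <= _); first by rewrite lerDl.
  by rewrite ler_eXnr // lerDr ltW.
rewrite rootE !hornerE subr_eq0 => /eqP yE; exists y => //.
rewrite lt_neqAle y0 andbT eq_sym; apply: contraTneq x0 => y00.
by rewrite -yE y00 expr0n gtn_eqF // ltxx.
Qed.

Lemma pos_root_complex (x : R[i]) : 0 < x ->
  forall m, (0 < m)%N -> exists2 y, 0 < y & y ^+ m = x.
Proof.
move=> /gt0_real_complex[-> x0] m m0; have [y y0 yE] := pos_root x0 m0.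
by exists y%:C; rewrite ?ltcR // -rmorphXn yE.
Qed.

Variable RR : realType.

Definition stdC (z : R[i]) : RR[i] := std RR (Re z) +i* std RR (Im z).

Lemma standard_part_complex : standard_part stdC.
Proof.
have P := standard_part_real R RR.
split.
- by rewrite /stdC /= (st1 P) (st0 P).
- move=> [a b] [c d] /fin_Re_Im[/= fa fb] /fin_Re_Im[/= fc fd].
  by rewrite /stdC /= (stD P fa fc) (stD P fb fd).
- move=> [a b] [c d] /fin_Re_Im[/= fa fb] /fin_Re_Im[/= fc fd].
  rewrite /stdC /= (stD P) ?(stN P) //; try (by [apply: finM | apply/arch_leN/finM]).
  by rewrite (stD P (finM fa fd) (finM fb fc)) !(stM P).
- move=> z fz; have [f1 f2] := fin_Re_Im fz.
  rewrite ge1_Re_Im -(st_neq0 P f1) -(st_neq0 P f2) /stdC eq_complex /= negb_and.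
  by split=> /orP.
Qed.

Lemma stdC_conj (z : R[i]) : fin z -> stdC (conjc z) = conjc (stdC z).
Proof.
case: z => a b /fin_Re_Im[/= _ fb].
by rewrite /stdC /= (stN (standard_part_real R RR) fb).
Qed.

End ComplexStandardPart.

(** * From archimedean domination to the valuation *)

Section Valuation.
Variables (R : rcfType) (RR : realType) (val : R -> \bar RR).
Hypotheses (Hval : is_valuation val) (Hord : order_compatible val).

(** Meaningful for nonzero [x] only: [fine] sends the value [-oo] at 0 to 0. *)
Definition nuR (x : R) : RR := fine (nu val x).

Lemma val_fin x : x != 0 -> val x = (- nuR x)%:E.
Proof.
case: Hval => H1 H2 _ _ x0; rewrite /nuR /nu.
case E : (val x) => [r||] /=.
- by rewrite opprK.
- by have /H1 x00 := E; rewrite x00 eqxx in x0.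
- by case: (H2 x).
Qed.

Lemma nuRM x y : x != 0 -> y != 0 -> nuR (x * y) = nuR x + nuR y.
Proof.
move=> x0 y0; case: Hval => _ _ H3 _; have := H3 x y.
rewrite !val_fin ?mulf_neq0 // -EFinD => -[]; lra.
Qed.

(** The ultrametric inequality, starting from 1. Together with order compatibility it makes
    archimedean classes finer than the valuation. *)
Lemma nuR_nat (m : nat) : nuR m.+1%:R <= 0.
Proof.
case: Hval => _ _ _ H4.
have n1 : nuR 1 = 0.
  by have := nuRM (oner_neq0 R) (oner_neq0 R); rewrite mulr1 -{1}[nuR 1]addr0 => /addrI.
elim: m => [|m IH]; first by rewrite n1.
have := H4 m.+1%:R 1; rewrite natr1 !val_fin ?pnatr_eq0 ?oner_neq0 // n1.
by rewrite -EFin_min lee_fin ge_min => /orP[]; lra.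
Qed.

Lemma nuR_le x y : 0 < x -> 0 < y -> arch_le x y -> nuR x <= nuR y.
Proof.
move=> x0 y0 [[|N]]; rewrite !gtr0_norm //; first by rewrite mul0r leNgt x0.
move=> xN; apply: (@le_trans _ _ (nuR (N.+1%:R * y))).
  move: xN; rewrite le_eqVlt => /orP[/eqP -> //|lt].
  have := Hord x0 lt; rewrite /nu !val_fin ?gt_eqF ?mulr_gt0 ?ltr0n //.
  by rewrite lee_fin !opprK.
rewrite nuRM ?gt_eqF ?ltr0n //; have := nuR_nat N; lra.
Qed.

(** Squaring makes an element of nonzero value positive; the square or its inverse has positive
    [nuR], which a finite positive element cannot have. *)
Lemma nonarchimedean_valued : nontrivial_valuation val -> exists2 x : R, 0 < x & ~ arch_le x 1.
Proof.
case=> x [/eqP x0 vx].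
have x2 : 0 < x * x by rewrite -expr2 exprn_even_gt0.
have n1 : nuR 1 = 0.
  by have := nuRM (oner_neq0 R) (oner_neq0 R); rewrite mulr1 -{1}[nuR 1]addr0 => /addrI.
have nx : nuR x != 0.
  by apply/negP => /eqP E; apply: vx; rewrite val_fin // E oppr0.
have := nuRM x0 x0.
have [lt E|gt E|E0] := ltgtP (nuR x) 0; last by rewrite E0 eqxx in nx.
  exists (x * x)^-1; first by rewrite invr_gt0.
  move=> /(nuR_le _ ltr01); rewrite invr_gt0 n1 => /(_ x2).
  have := nuRM (lt0r_neq0 x2) (invr_neq0 (lt0r_neq0 x2)).
  by rewrite mulfV ?lt0r_neq0 // n1; lra.
by exists (x * x) => // /(nuR_le x2 ltr01); rewrite n1; lra.
Qed.

Definition nuRC (z : R[i]) : RR := fine (nuC val z).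

(** Positive elements of [R[i]] are real, and a zero imaginary part contributes [-oo] to the
    maximum. *)
Lemma nuRC_pos z : 0 < z -> nuRC z = nuR (complex.Re z).
Proof.
move=> /gt0_real_complex[zE z0]; rewrite /nuRC /nuC zE /=.
have -> : nu val 0 = -oo%E by case: Hval => H1 _ _ _; rewrite /nu (H1 0).2.
by rewrite maxeNy.
Qed.

End Valuation.

Theorem theorem4p5 (R : rcfType) (RR : realType) (val : R -> \bar RR)
  (Hval : is_valuation val) (Hnt : nontrivial_valuation val)
  (Hres : infinite_residue_field val) (Hord : order_compatible val)
  (n : nat) (Hn : (0 < n)%N) :
  (forall A : 'M[R]_n, symmetric_mx A -> posdef A ->
     coarsens_realizable_matroid_subdivision RR
       (fun S => fine (nu val (pminor A S))))
  /\
  (forall A : 'M[R[i]]_n, hermitian_mx A -> posdef A ->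
     coarsens_realizable_matroid_subdivision RR[i]
       (fun S => fine (nuC val (pminor A S)))).
Proof.
have [x0 x00 nx0] := nonarchimedean_valued Hval Hord Hnt.
split=> A Ah Apos.
  apply: (@posdef_minors_coarsen R RR idfun idfun _ _ _ _ (std RR) _ _ RR (nuR val)) => //.
  - by move=> x; rewrite -expr2 real_normK ?num_real.
  - by move=> x; rewrite -expr2 real_normK ?num_real.
  - exact: pos_root.
  - by exists x0.
  - exact: standard_part_real.
  - by move=> x y x_gt0 y_gt0; apply: nuRM; rewrite ?lt0r_neq0.
  - exact: nuR_le.
  - by rewrite map_mx_id.
apply: (@posdef_minors_coarsen R[i] RR[i] (@conjc R) (@conjc RR) _ _ _ _ (@stdC R RR) _ _ RR (nuRC val)) => //.
- by move=> x; rewrite sqr_normc.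
- by move=> x; rewrite sqr_normc.
- exact: pos_root_complex.
- exists (real_complex R x0); first by rewrite ltcR.
  by rewrite -(rmorph1 (real_complex R)) => /arch_le_real.
- exact: standard_part_complex.
- by move=> x; apply: stdC_conj.
- move=> x y x_gt0 y_gt0; rewrite !nuRC_pos ?mulr_gt0 //.
  have [xE xr] := gt0_real_complex x_gt0; have [yE yr] := gt0_real_complex y_gt0.
  by rewrite {1}xE {1}yE -rmorphM /= nuRM ?lt0r_neq0.
- move=> x y x_gt0 y_gt0; rewrite !nuRC_pos //.
  have [xE xr] := gt0_real_complex x_gt0; have [yE yr] := gt0_real_complex y_gt0.
  by rewrite xE yE => /arch_le_real /nuR_le; apply.
Qed.
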